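(* Let $\mathscr{M}$ be a bicategory which has tabulations from the terminal. Then the class $\mathrm{Tab}$, of all morphisms $p:U\to X$ in $\mathscr{M}$ which occur as the right leg of a tabulation of some morphism $u:1\to X$, is a calibration of $\mathscr{M}$.
   Context: **Tabulations from the terminal.** For a bicategory $\mathscr{M}$, let $\mathscr{M}_*$ be the sub-bicategory obtained by restricting to left adjoint morphisms. $\mathscr{M}$ has tabulations from the terminal when: (i) the bicategory $\mathscr{M}_*$ has a (bicategorical) terminal object $1$ such that, for all objects $U$, the unique-up-to-isomorphism left-adjoint morphism $!_U:U\to1$ is terminal in the category $\mathscr{M}(U,1)$; (ii) each morphism $u:1\to X$ in $\mathscr{M}$ has a tabulation. A tabulation of $u$ consists of an object $U$, a left adjoint morphism $p:U\to X$ (the right leg) and a 2-cell $\rho_u:p\Rightarrow u\,!_U$ such that, for all objects $K$, the natural transformation $\lambda$ from $\mathscr{M}(K,p):\mathscr{M}(K,U)\to\mathscr{M}(K,X)$ to the functor constant at $u\,!_K$, with component $pw\xRightarrow{\rho_uw}u\,!_U\,w\xRightarrow{u!}u\,!_K$ at $w\in\mathscr{M}(K,U)$ (where $!$ denotes the unique 2-cell $!_Uw\Rightarrow{!_K}$), exhibits $\mathscr{M}(K,U)$ as a bicategorical comma object in $\mathrm{Cat}$ of the identity functor of $\mathscr{M}(K,X)$ and $u\,!_K:\mathbf{1}\to\mathscr{M}(K,X)$; that is, the induced functor $\mathscr{M}(K,U)\to\mathscr{M}(K,X)/(u\,!_K)$ into the slice category is an equivalence. **Bipullback.** In a bicategory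 $\mathscr{M}$, a square given by $d:P\to A$, $c:P\to B$, $n:A\to C$, $p:B\to C$ and an invertible 2-cell $\theta:nd\Rightarrow pc$ is a bipullback of $(n,p)$ when, for all objects $K$, the functor $\mathscr{M}(K,P)\to \mathscr{M}(K,n)/_{\mathrm{ps}}\mathscr{M}(K,p)$, $u\mapsto(du,\theta u,cu)$, is an equivalence. Here, for functors $F:\mathscr{X}\to\mathscr{Z}$ and $G:\mathscr{Y}\to\mathscr{Z}$, the category $F/_{\mathrm{ps}}G$ has objects $(x,\alpha,y)$ with $\alpha:Fx\cong Gy$, and morphisms $(s,t):(x,\alpha,y)\to(x',\alpha',y')$ the pairs with $(Gt)\alpha=\alpha'(Fs)$. **Groupoid fibration.** A functor $p:E\to B$ is a groupoid fibration when (i) for all $e\in E$ and $\beta:b\to pe$ in $B$ there exist $\chi:e'\to e$ in $E$ and an isomorphism $b\cong pe'$ whose composite with $p\chi$ is $\beta$; and (ii) every morphism $\chi:e'\to e$ of $E$ is cartesian: for all $k\in E$ the square with sides $E(k,\chi):E(k,e')\to E(k,e)$, $B(pk,p\chi):B(pk,pe')\to B(pk,pe)$ and the two functions induced by $p$ is a pullback. A morphism $p:E\to B$ in a bicategory $\mathscr{M}$ is a groupoid fibration when the functor $\mathscr{M}(K,p)$ is one for every object $K$. **Right lifter.** A morphism $n:Y\to Z$ in $\mathscr{M}$ is a right lifter when every $u:K\to Z$ has a right lifting through $n$: a morphism $\mathrm{rif}(n,u):K\to Y$ with a 2-cell $\varpi:n\,\mathrm{rif}(n,u)\Rightarrow u$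 such that pasting with $\varpi$ is a bijection between 2-cells $v\Rightarrow\mathrm{rif}(n,u)$ and 2-cells $nv\Rightarrow u$, for all $v:K\to Y$. **Calibration.** A class $\mathscr{P}$ of morphisms (called neat) of a bicategory $\mathscr{M}$ is a calibration when: (P0) all equivalences are neat, and any morphism isomorphic to a neat one is neat; (P1) for all neat $p$, a composite $p\circ q$ is neat if and only if $q$ is neat; (P2) every neat morphism is a groupoid fibration; (P3) every cospan $S\xrightarrow{p}Y\xleftarrow{n}T$ with $n$ a right lifter and $p$ neat has a bipullback with projections $\tilde n:P\to S$ and $\tilde p:P\to T$ in which $\tilde p$ is neat. *)

(* Defs.v *)
From Stdlib Require Import ssreflect ProofIrrelevance.

Set Implicit Arguments.
Unset Strict Implicit.
Unset Printing Implicit Defensive.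

Declare Scope bicat_scope.
Delimit Scope bicat_scope with bicat.
Local Open Scope bicat_scope.

Reserved Notation "x ⟶ y" (at level 70, no associativity).
Reserved Notation "g ∘ f" (at level 45, right associativity).
Reserved Notation "g ⊙ f" (at level 38, left associativity).
Reserved Notation "b ⋆ a" (at level 41, no associativity).
Reserved Notation "g ◁ a" (at level 41, no associativity).
Reserved Notation "b ▷ f" (at level 41, no associativity).

(** * Categories *)

Record Category := {
  ob :> Type;
  hom : ob -> ob -> Type;
  idm : forall x, hom x x;
  comp : forall x y z, hom y z -> hom x y -> hom x z;
  comp_idl : forall x y (f : hom x y), comp (idm y) f = f;
  comp_idr : forall x y (f : hom x y), comp f (idm x) = f;
  comp_assoc : forall x y z t (h : hom z t) (g : hom y z) (f : hom x y),
    comp (comp h g) f = comp h (comp g f)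
}.
Arguments idm {c} x.
Arguments comp {c x y z} g f : rename.

Notation "x ⟶ y" := (hom x y) : bicat_scope.
Notation "g ∘ f" := (comp g f) : bicat_scope.

Record Iso (C : Category) (x y : C) := {
  fwd :> x ⟶ y;
  bwd : y ⟶ x;
  fwd_bwd : fwd ∘ bwd = idm y;
  bwd_fwd : bwd ∘ fwd = idm x
}.
Arguments fwd {C x y} i : rename.
Arguments bwd {C x y} i : rename.

Definition iso_inv (C : Category) (x y : C) (i : Iso x y) : Iso y x :=
  {| fwd := bwd i; bwd := fwd i; fwd_bwd := bwd_fwd i; bwd_fwd := fwd_bwd i |}.

Lemma iso_comp_fwd_bwd (C : Category) (x y z : C) (j : Iso y z) (i : Iso x y) :
  (j ∘ i) ∘ (bwd i ∘ bwd j) = idm z.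
Proof. by rewrite comp_assoc -(comp_assoc i) fwd_bwd comp_idl fwd_bwd. Qed.

Definition iso_comp (C : Category) (x y z : C) (j : Iso y z) (i : Iso x y) :
  Iso x z :=
  {| fwd := j ∘ i; bwd := bwd i ∘ bwd j;
     fwd_bwd := iso_comp_fwd_bwd j i;
     bwd_fwd := iso_comp_fwd_bwd (iso_inv i) (iso_inv j) |}.

(** [t] is a terminal object; the (unique) morphisms into it are data. *)
Record Terminal (C : Category) (t : C) := {
  to_terminal : forall x, x ⟶ t;
  to_terminal_unique : forall x (f g : x ⟶ t), f = g
}.

Record Functor (C D : Category) := {
  fobj :> C -> D;
  fmap : forall x y, (x ⟶ y) -> (fobj x ⟶ fobj y);
  fmap_id : forall x, fmap (idm x) = idm (fobj x);
  fmap_comp : forall x y z (g : y ⟶ z) (f : x ⟶ y),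
    fmap (g ∘ f) = fmap g ∘ fmap f
}.
Arguments fmap {C D} F {x y} f : rename.

Definition functor_id (C : Category) : Functor C C :=
  {| fobj := fun x => x; fmap := fun _ _ f => f;
     fmap_id := fun _ => eq_refl; fmap_comp := fun _ _ _ _ _ => eq_refl |}.

Definition functor_comp (C D E : Category) (G : Functor D E) (F : Functor C D) :
  Functor C E.
Proof.
refine {| fobj := fun x => G (F x); fmap := fun _ _ f => fmap G (fmap F f) |}.
- by move=> x; rewrite !fmap_id.
- by move=> x y z g f; rewrite !fmap_comp.
Defined.

Record NatIso (C D : Category) (F G : Functor C D) := {
  natiso :> forall x, Iso (F x) (G x);
  natiso_natural : forall x y (f : x ⟶ y),
    natiso y ∘ fmap F f = fmap G f ∘ natiso x
}.

Definition is_equivalence_of_categories (C D : Category) (F : Functor C D) :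
  Prop :=
  exists G : Functor D C,
    inhabited (NatIso (functor_comp G F) (functor_id C)) /\
    inhabited (NatIso (functor_comp F G) (functor_id D)).

Definition one_category : Category :=
  {| ob := unit; hom := fun _ _ => unit; idm := fun _ => tt;
     comp := fun _ _ _ _ _ => tt;
     comp_idl := fun _ _ f => match f with tt => eq_refl end;
     comp_idr := fun _ _ f => match f with tt => eq_refl end;
     comp_assoc := fun _ _ _ _ _ _ _ => eq_refl |}.

Definition functor_to_one (C : Category) : Functor C one_category :=
  {| fobj := fun _ => tt : one_category;
     fmap := fun _ _ _ => tt : hom (c := one_category) tt tt;
     fmap_id := fun _ => eq_refl; fmap_comp := fun _ _ _ _ _ => eq_refl |}.

Definition full_subcategory (C : Category) (P : C -> Prop) : Category :=
  {| ob := {x : C | P x};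
     hom := fun x y => proj1_sig x ⟶ proj1_sig y;
     idm := fun x => idm (proj1_sig x);
     comp := fun _ _ _ g f => g ∘ f;
     comp_idl := fun _ _ f => comp_idl f;
     comp_idr := fun _ _ f => comp_idr f;
     comp_assoc := fun _ _ _ _ h g f => comp_assoc h g f |}.

Lemma sig_ext (A : Type) (P : A -> Prop) (a b : {x : A | P x}) :
  proj1_sig a = proj1_sig b -> a = b.
Proof.
case: a b => [a Pa] [b Pb] /= E; subst b.
by rewrite (proof_irrelevance _ Pa Pb).
Qed.

Definition slice_hom (C : Category) (c : C) (x y : {x : C & x ⟶ c}) : Type :=
  {f : projT1 x ⟶ projT1 y | projT2 y ∘ f = projT2 x}.

Definition slice_comp (C : Category) (c : C) (x y z : {x : C & x ⟶ c})
    (g : slice_hom y z) (f : slice_hom x y) : slice_hom x z.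
Proof.
exists (proj1_sig g ∘ proj1_sig f).
by rewrite -comp_assoc (proj2_sig g) (proj2_sig f).
Defined.

Definition slice (C : Category) (c : C) : Category.
Proof.
refine {| ob := {x : C & x ⟶ c};
          hom := @slice_hom C c;
          idm := fun x => exist _ (idm (projT1 x)) (comp_idr _);
          comp := @slice_comp C c |}.
- by move=> x y f; apply: sig_ext; rewrite /= comp_idl.
- by move=> x y f; apply: sig_ext; rewrite /= comp_idr.
- by move=> x y z t h g f; apply: sig_ext; rewrite /= comp_assoc.
Defined.

(** The functor into the slice induced by a functor [F] and a natural
    transformation from [F] to the functor constant at [c]. *)
Definition functor_to_slice (C D : Category) (F : Functor C D) (c : D)
    (lam : forall x, F x ⟶ c)
    (lam_nat : forall x y (f : x ⟶ y), lam y ∘ fmap F f = lam x) :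
  Functor C (slice c).
Proof.
refine {| fobj := fun x => existT _ (F x) (lam x) : slice c;
          fmap := fun x y f => exist _ (fmap F f) (lam_nat x y f) |}.
- by move=> x; apply: sig_ext; rewrite /= fmap_id.
- by move=> x y z g f; apply: sig_ext; rewrite /= fmap_comp.
Defined.

Record PsObj (X Y Z : Category) (F : Functor X Z) (G : Functor Y Z) := {
  ps_fst : X;
  ps_snd : Y;
  ps_iso : Iso (F ps_fst) (G ps_snd)
}.

Definition ps_hom (X Y Z : Category) (F : Functor X Z) (G : Functor Y Z)
    (a b : PsObj F G) : Type :=
  {st : (ps_fst a ⟶ ps_fst b) * (ps_snd a ⟶ ps_snd b)
      | fmap G (snd st) ∘ ps_iso a = ps_iso b ∘ fmap F (fst st)}.

Definition ps_idm (X Y Z : Category) (F : Functor X Z) (G : Functor Y Z)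
    (a : PsObj F G) : ps_hom a a.
Proof.
exists (idm (ps_fst a), idm (ps_snd a)).
by rewrite /= !fmap_id comp_idl comp_idr.
Defined.

Definition ps_comp (X Y Z : Category) (F : Functor X Z) (G : Functor Y Z)
    (a b c : PsObj F G) (g : ps_hom b c) (f : ps_hom a b) : ps_hom a c.
Proof.
exists (fst (proj1_sig g) ∘ fst (proj1_sig f),
        snd (proj1_sig g) ∘ snd (proj1_sig f)).
case: g f => [[s t] /= e] [[s' t'] /= e'].
by rewrite !fmap_comp comp_assoc e' -comp_assoc e comp_assoc.
Defined.

Definition pseudo_comma (X Y Z : Category) (F : Functor X Z) (G : Functor Y Z) :
  Category.
Proof.
refine {| ob := PsObj F G; hom := @ps_hom X Y Z F G;
          idm := @ps_idm X Y Z F G; comp := @ps_comp X Y Z F G |}.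
- by move=> a b [[s t] e]; apply: sig_ext; rewrite /= !comp_idl.
- by move=> a b [[s t] e]; apply: sig_ext; rewrite /= !comp_idr.
- by move=> a b c d h g f; apply: sig_ext; rewrite /= !comp_assoc.
Defined.

Definition functor_to_pseudo_comma (W X Y Z : Category)
    (F : Functor X Z) (G : Functor Y Z) (D : Functor W X) (E : Functor W Y)
    (th : NatIso (functor_comp F D) (functor_comp G E)) :
  Functor W (pseudo_comma F G).
Proof.
refine {| fobj := fun w => {| ps_fst := D w; ps_snd := E w; ps_iso := th w |}
                           : pseudo_comma F G;
          fmap := fun v w f =>
            exist _ (fmap D f, fmap E f) (eq_sym (natiso_natural th f)) |}.
- by move=> x; apply: sig_ext; rewrite /= !fmap_id.
- by move=> x y z g f; apply: sig_ext; rewrite /= !fmap_comp.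
Defined.

Definition is_set_pullback (P A B C : Type)
    (p : P -> A) (q : P -> B) (f : A -> C) (g : B -> C) : Prop :=
  (forall x, f (p x) = g (q x)) /\
  (forall a b, f a = g b -> exists! x, p x = a /\ q x = b).

Definition is_cartesian (E B : Category) (p : Functor E B) (e' e : E)
    (chi : e' ⟶ e) : Prop :=
  forall k : E,
    is_set_pullback (fun h : k ⟶ e' => chi ∘ h)
                    (fun h : k ⟶ e' => fmap p h)
                    (fun h : k ⟶ e => fmap p h)
                    (fun h : p k ⟶ p e' => fmap p chi ∘ h).

Definition is_groupoid_fibration_of_categories (E B : Category)
    (p : Functor E B) : Prop :=
  (forall (e : E) (b : B) (beta : b ⟶ p e),
     exists (e' : E) (chi : e' ⟶ e) (i : Iso b (p e')), fmap p chi ∘ i = beta) /\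
  (forall (e' e : E) (chi : e' ⟶ e), is_cartesian p chi).

(** * Bicategories *)

(** Horizontal composition [comp1], [comp2] is a functor of two variables,
    spelled out; the associator and unitors are natural isomorphisms. *)
Record Bicategory := {
  bob :> Type;
  bhom : bob -> bob -> Category;
  id1 : forall A, bhom A A;
  comp1 : forall A B C, bhom B C -> bhom A B -> bhom A C;
  comp2 : forall A B C (g g' : bhom B C) (f f' : bhom A B),
    (g ⟶ g') -> (f ⟶ f') -> (comp1 g f ⟶ comp1 g' f');
  comp2_id : forall A B C (g : bhom B C) (f : bhom A B),
    comp2 (idm g) (idm f) = idm (comp1 g f);
  comp2_comp : forall A B C (g g' g'' : bhom B C) (f f' f'' : bhom A B)
      (b' : g' ⟶ g'') (b : g ⟶ g') (a' : f' ⟶ f'') (a : f ⟶ f'),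
    comp2 (b' ∘ b) (a' ∘ a) = comp2 b' a' ∘ comp2 b a;
  assoc : forall A B C D (h : bhom C D) (g : bhom B C) (f : bhom A B),
    Iso (comp1 (comp1 h g) f) (comp1 h (comp1 g f));
  lunit : forall A B (f : bhom A B), Iso (comp1 (id1 B) f) f;
  runit : forall A B (f : bhom A B), Iso (comp1 f (id1 A)) f;
  assoc_natural : forall A B C D (h h' : bhom C D) (g g' : bhom B C)
      (f f' : bhom A B) (c : h ⟶ h') (b : g ⟶ g') (a : f ⟶ f'),
    assoc h' g' f' ∘ comp2 (comp2 c b) a = comp2 c (comp2 b a) ∘ assoc h g f;
  lunit_natural : forall A B (f f' : bhom A B) (a : f ⟶ f'),
    lunit f' ∘ comp2 (idm (id1 B)) a = a ∘ lunit f;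
  runit_natural : forall A B (f f' : bhom A B) (a : f ⟶ f'),
    runit f' ∘ comp2 a (idm (id1 A)) = a ∘ runit f;
  pentagon : forall A B C D E (k : bhom D E) (h : bhom C D) (g : bhom B C)
      (f : bhom A B),
    assoc k h (comp1 g f) ∘ assoc (comp1 k h) g f =
    comp2 (idm k) (assoc h g f) ∘ assoc k (comp1 h g) f
      ∘ comp2 (assoc k h g) (idm f);
  triangle : forall A B C (g : bhom B C) (f : bhom A B),
    comp2 (idm g) (lunit f) ∘ assoc g (id1 B) f = comp2 (runit g) (idm f)
}.
Arguments id1 {b} A : rename.
Arguments comp1 {b A B C} g f : rename.
Arguments comp2 {b A B C g g' f f'} _ _ : rename.

Coercion bhom : Bicategory >-> Funclass.

Notation "g ⊙ f" := (comp1 g f) : bicat_scope.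
Notation "b ⋆ a" := (comp2 b a) : bicat_scope.
Notation "g ◁ a" := (comp2 (idm g) a) : bicat_scope.
Notation "b ▷ f" := (comp2 b (idm f)) : bicat_scope.

(** The functor [M(K, p)]. *)
Definition postcomp (M : Bicategory) (K A B : M) (p : M A B) :
  Functor (M K A) (M K B).
Proof.
refine {| fobj := fun w => p ⊙ w : M K B; fmap := fun _ _ s => p ◁ s |}.
- by move=> x; rewrite comp2_id.
- by move=> x y z g f; rewrite -comp2_comp comp_idl.
Defined.

Definition is_equivalence (M : Bicategory) (A B : M) (f : M A B) : Prop :=
  exists g : M B A, inhabited (Iso (g ⊙ f) (id1 A)) /\
                    inhabited (Iso (f ⊙ g) (id1 B)).

Definition is_bicategorical_terminal (M : Bicategory) (t : M) : Prop :=
  forall U : M, is_equivalence_of_categories (functor_to_one (M U t)).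

(** Adjunctions [f ⊣ g]. Each triangle identity has its unit constraint
    isomorphisms moved to one side. *)
Record Adjunction (M : Bicategory) (A B : M) (f : M A B) (g : M B A) := {
  adj_unit : id1 A ⟶ g ⊙ f;
  adj_counit : f ⊙ g ⟶ id1 B;
  adj_triangle_l :
    lunit f ∘ (adj_counit ▷ f) ∘ bwd (assoc f g f) ∘ (f ◁ adj_unit) = runit f;
  adj_triangle_r :
    runit g ∘ (g ◁ adj_counit) ∘ assoc g f g ∘ (adj_unit ▷ g) = lunit g
}.

Definition is_left_adjoint (M : Bicategory) (A B : M) (f : M A B) : Prop :=
  exists g : M B A, inhabited (Adjunction f g).

(** ** Left adjoints are closed under composition *)

Lemma iso_cancel_l (C : Category) (x y z : C) (i : Iso y z) (f g : x ⟶ y) :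
  i ∘ f = i ∘ g -> f = g.
Proof.
by move=> E; rewrite -(comp_idl f) -(comp_idl g) -(bwd_fwd i) !comp_assoc E.
Qed.

Lemma iso_cancel_r (C : Category) (x y z : C) (i : Iso x y) (f g : y ⟶ z) :
  f ∘ i = g ∘ i -> f = g.
Proof.
by move=> E; rewrite -(comp_idr f) -(comp_idr g) -(fwd_bwd i) -!comp_assoc E.
Qed.

Lemma fwd_bwdK (C : Category) (x y z : C) (i : Iso x y) (f : z ⟶ y) :
  i ∘ bwd i ∘ f = f.
Proof. by rewrite -comp_assoc fwd_bwd comp_idl. Qed.

Lemma bwd_fwdK (C : Category) (x y z : C) (i : Iso x y) (f : z ⟶ x) :
  bwd i ∘ i ∘ f = f.
Proof. by rewrite -comp_assoc bwd_fwd comp_idl. Qed.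

Lemma comp_eq (C : Category) (x y z : C) (f g : y ⟶ z) (t : x ⟶ y) :
  f = g -> f ∘ t = g ∘ t.
Proof. by move=> ->. Qed.

Lemma lwhisker_comp (M : Bicategory) (A B C : M) (g : M B C) (f f' f'' : M A B)
    (b : f' ⟶ f'') (a : f ⟶ f') : g ◁ (b ∘ a) = (g ◁ b) ∘ (g ◁ a).
Proof. by rewrite -comp2_comp comp_idl. Qed.

Lemma rwhisker_comp (M : Bicategory) (A B C : M) (f : M A B) (g g' g'' : M B C)
    (b : g' ⟶ g'') (a : g ⟶ g') : (b ∘ a) ▷ f = (b ▷ f) ∘ (a ▷ f).
Proof. by rewrite -comp2_comp comp_idl. Qed.

Lemma whisker_exchange (M : Bicategory) (A B C : M) (g g' : M B C)
    (f f' : M A B) (b : g ⟶ g') (a : f ⟶ f') :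
  (b ▷ f') ∘ (g ◁ a) = (g' ◁ a) ∘ (b ▷ f).
Proof. by rewrite -!comp2_comp !comp_idl !comp_idr. Qed.

Lemma lunit_lwhisker (M : Bicategory) (A B : M) (f : M A B) :
  id1 B ◁ lunit f = lunit (id1 B ⊙ f).
Proof. by apply: (iso_cancel_l (i := lunit f)); rewrite lunit_natural. Qed.

Lemma runit_rwhisker (M : Bicategory) (A B : M) (f : M A B) :
  runit f ▷ id1 A = runit (f ⊙ id1 A).
Proof. by apply: (iso_cancel_l (i := runit f)); rewrite runit_natural. Qed.

Lemma id1_lwhisker_inj (M : Bicategory) (A B : M) (f g : M A B) (a b : f ⟶ g) :
  id1 B ◁ a = id1 B ◁ b -> a = b.
Proof.
move=> E; apply: (iso_cancel_r (i := lunit f)).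
by rewrite -!lunit_natural E.
Qed.

Lemma id1_rwhisker_inj (M : Bicategory) (A B : M) (f g : M A B) (a b : f ⟶ g) :
  a ▷ id1 A = b ▷ id1 A -> a = b.
Proof.
move=> E; apply: (iso_cancel_r (i := runit f)).
by rewrite -!runit_natural E.
Qed.

Lemma lwhisker_iso_fwd_bwd (M : Bicategory) (A B C : M) (g : M B C)
    (f f' : M A B) (i : Iso f f') : (g ◁ i) ∘ (g ◁ bwd i) = idm (g ⊙ f').
Proof. by rewrite -lwhisker_comp fwd_bwd comp2_id. Qed.

Definition lwhisker_iso (M : Bicategory) (A B C : M) (g : M B C)
    (f f' : M A B) (i : Iso f f') : Iso (g ⊙ f) (g ⊙ f') :=
  {| fwd := g ◁ i; bwd := g ◁ bwd i;
     fwd_bwd := lwhisker_iso_fwd_bwd g i;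
     bwd_fwd := lwhisker_iso_fwd_bwd g (iso_inv i) |}.

Lemma rwhisker_iso_fwd_bwd (M : Bicategory) (A B C : M) (f : M A B)
    (g g' : M B C) (i : Iso g g') : (i ▷ f) ∘ (bwd i ▷ f) = idm (g' ⊙ f).
Proof. by rewrite -rwhisker_comp fwd_bwd comp2_id. Qed.

Definition rwhisker_iso (M : Bicategory) (A B C : M) (f : M A B)
    (g g' : M B C) (i : Iso g g') : Iso (g ⊙ f) (g' ⊙ f) :=
  {| fwd := i ▷ f; bwd := bwd i ▷ f;
     fwd_bwd := rwhisker_iso_fwd_bwd f i;
     bwd_fwd := rwhisker_iso_fwd_bwd f (iso_inv i) |}.

Lemma lunit_comp1 (M : Bicategory) (A B C : M) (g : M B C) (f : M A B) :
  lunit (g ⊙ f) ∘ assoc (id1 C) g f = lunit g ▷ f.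
Proof.
apply: id1_lwhisker_inj.
apply: (iso_cancel_r (i := assoc (id1 C) (id1 C ⊙ g) f)).
apply: (iso_cancel_r (i := rwhisker_iso f (assoc (id1 C) (id1 C) g))).
rewrite /= lwhisker_comp !comp_assoc -pentagon -comp_assoc triangle.
rewrite -(comp2_id g f) -assoc_natural -comp_assoc.
have /= <- := assoc_natural (idm (id1 C)) (lunit g) (idm f).
by rewrite comp_assoc -rwhisker_comp triangle.
Qed.

Lemma runit_comp1 (M : Bicategory) (A B C : M) (g : M B C) (f : M A B) :
  (g ◁ runit f) ∘ assoc g f (id1 A) = runit (g ⊙ f).
Proof.
apply: id1_rwhisker_inj.
apply: (iso_cancel_l (i := assoc g f (id1 A))).
rewrite rwhisker_comp -comp_assoc.
have /= -> := assoc_natural (idm g) (runit f) (idm (id1 A)).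
rewrite -triangle lwhisker_comp !comp_assoc -pentagon -comp_assoc.
rewrite -(assoc_natural (idm g) (idm f) (lunit (id1 A))) comp2_id.
by rewrite comp_assoc triangle.
Qed.

Lemma lunit_id1 (M : Bicategory) (A : M) :
  fwd (lunit (id1 A)) = runit (id1 A).
Proof.
apply: id1_rwhisker_inj; rewrite -triangle -lunit_comp1.
by rewrite lunit_lwhisker.
Qed.

(** The components at [x] of the counit and at [w] of the unit of
    [M(K, f) ⊣ M(K, g)]. *)
Definition counit_at (M : Bicategory) (A B : M) (f : M A B) (g : M B A)
    (e : f ⊙ g ⟶ id1 B) (K : M) (x : M K B) : f ⊙ (g ⊙ x) ⟶ x :=
  lunit x ∘ (e ▷ x) ∘ bwd (assoc f g x).

Definition unit_at (M : Bicategory) (A B : M) (f : M A B) (g : M B A)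
    (n : id1 A ⟶ g ⊙ f) (K : M) (w : M K A) : w ⟶ g ⊙ (f ⊙ w) :=
  assoc g f w ∘ (n ▷ w) ∘ bwd (lunit w).

Lemma assoc_bwd_natural (M : Bicategory) (A B C D : M) (h h' : M C D)
    (g g' : M B C) (f f' : M A B) (c : h ⟶ h') (b : g ⟶ g') (a : f ⟶ f') :
  ((c ⋆ b) ⋆ a) ∘ bwd (assoc h g f) = bwd (assoc h' g' f') ∘ (c ⋆ (b ⋆ a)).
Proof.
apply: (iso_cancel_l (i := assoc h' g' f')).
by rewrite fwd_bwdK -comp_assoc assoc_natural comp_assoc fwd_bwd comp_idr.
Qed.

Lemma lunit_bwd_natural (M : Bicategory) (A B : M) (f f' : M A B) (a : f ⟶ f') :
  (id1 B ◁ a) ∘ bwd (lunit f) = bwd (lunit f') ∘ a.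
Proof.
apply: (iso_cancel_l (i := lunit f')).
by rewrite fwd_bwdK -comp_assoc lunit_natural comp_assoc fwd_bwd comp_idr.
Qed.

Lemma counit_at_natural (M : Bicategory) (A B : M) (f : M A B) (g : M B A)
    (e : f ⊙ g ⟶ id1 B) (K : M) (x y : M K B) (a : x ⟶ y) :
  counit_at e y ∘ (f ◁ (g ◁ a)) = a ∘ counit_at e x.
Proof.
rewrite /counit_at !comp_assoc -assoc_bwd_natural comp2_id.
rewrite -(comp_assoc (e ▷ y)) whisker_exchange !comp_assoc.
by rewrite -(comp_assoc (lunit y)) lunit_natural !comp_assoc.
Qed.

Lemma unit_at_natural (M : Bicategory) (A B : M) (f : M A B) (g : M B A)
    (n : id1 A ⟶ g ⊙ f) (K : M) (x y : M K A) (a : x ⟶ y) :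
  unit_at n y ∘ a = (g ◁ (f ◁ a)) ∘ unit_at n x.
Proof.
rewrite /unit_at !comp_assoc -lunit_bwd_natural.
rewrite -(comp_assoc (n ▷ y)) whisker_exchange !comp_assoc.
by rewrite -comp2_id -(comp_assoc (assoc g f y)) assoc_natural !comp_assoc.
Qed.

Lemma counit_at_comp1 (M : Bicategory) (A B : M) (f : M A B) (g : M B A)
    (e : f ⊙ g ⟶ id1 B) (K L : M) (x : M K B) (h : M L K) :
  counit_at e (x ⊙ h) ∘ (f ◁ assoc g x h) ∘ assoc f (g ⊙ x) h
  = counit_at e x ▷ h.
Proof.
apply: (iso_cancel_r (i := rwhisker_iso h (assoc f g x))).
rewrite /counit_at /= !comp_assoc -pentagon bwd_fwdK -rwhisker_comp.
rewrite !comp_assoc bwd_fwd comp_idr rwhisker_comp -lunit_comp1 comp_assoc.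
by rewrite assoc_natural comp2_id.
Qed.

Lemma unit_at_comp1 (M : Bicategory) (A B : M) (f : M A B) (g : M B A)
    (n : id1 A ⟶ g ⊙ f) (K L : M) (w : M K A) (h : M L K) :
  (g ◁ assoc f w h) ∘ assoc g (f ⊙ w) h ∘ (unit_at n w ▷ h)
  = unit_at n (w ⊙ h).
Proof.
apply: (iso_cancel_r (i := lunit (w ⊙ h))).
apply: (iso_cancel_r (i := assoc (id1 A) w h)).
rewrite /unit_at !comp_assoc bwd_fwdK lunit_comp1 -rwhisker_comp.
rewrite !comp_assoc bwd_fwd comp_idr rwhisker_comp.
rewrite -(comp2_id w h) -assoc_natural -[RHS]comp_assoc pentagon.
by rewrite !comp_assoc.
Qed.

Lemma counit_at_unit_at (M : Bicategory) (A B : M) (f : M A B) (g : M B A)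
    (a : Adjunction f g) (K : M) (w : M K A) :
  counit_at (adj_counit a) (f ⊙ w) ∘ (f ◁ unit_at (adj_unit a) w)
  = idm (f ⊙ w).
Proof.
apply: (iso_cancel_r (i := lwhisker_iso f (lunit w))).
apply: (iso_cancel_r (i := assoc f (id1 A) w)).
rewrite /= !comp_assoc -(comp_assoc (f ◁ unit_at _ w)) -lwhisker_comp.
rewrite /unit_at !comp_assoc bwd_fwd comp_idr lwhisker_comp !comp_assoc.
rewrite -assoc_natural comp_idl triangle -(adj_triangle_l a).
have /(comp_eq ((f ◁ adj_unit a) ▷ w)) :=
  counit_at_comp1 (adj_counit a) f w.
rewrite !comp_assoc => ->.
by rewrite -rwhisker_comp /counit_at !comp_assoc.
Qed.

Lemma unit_at_counit_at (M : Bicategory) (A B : M) (f : M A B) (g : M B A)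
    (a : Adjunction f g) (K : M) (x : M K B) :
  (g ◁ counit_at (adj_counit a) x) ∘ unit_at (adj_unit a) (g ⊙ x)
  = idm (g ⊙ x).
Proof.
rewrite -unit_at_comp1 /counit_at !lwhisker_comp !comp_assoc.
have /= -> := bwd_fwdK (lwhisker_iso g (assoc f g x)).
rewrite -[(g ◁ (_ ▷ x)) ∘ _]comp_assoc -assoc_natural !comp_assoc.
rewrite -(comp_assoc (g ◁ lunit x)) triangle -!rwhisker_comp /unit_at.
have := adj_triangle_r a.
move=> /(comp_eq (bwd (lunit g))); rewrite !comp_assoc fwd_bwd => ->.
by rewrite comp2_id.
Qed.

Definition comp_counit (M : Bicategory) (A B C : M) (f : M A B) (g : M B A)
    (f' : M B C) (g' : M C B) (e : f ⊙ g ⟶ id1 B) (e' : f' ⊙ g' ⟶ id1 C) :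
  (f' ⊙ f) ⊙ (g ⊙ g') ⟶ id1 C :=
  e' ∘ (f' ◁ counit_at e g') ∘ assoc f' f (g ⊙ g').

Definition comp_unit (M : Bicategory) (A B C : M) (f : M A B) (g : M B A)
    (f' : M B C) (g' : M C B) (n : id1 A ⟶ g ⊙ f) (n' : id1 B ⟶ g' ⊙ f') :
  id1 A ⟶ (g ⊙ g') ⊙ (f' ⊙ f) :=
  bwd (assoc g g' (f' ⊙ f)) ∘ (g ◁ unit_at n' f) ∘ n.

Lemma counit_at_comp_counit (M : Bicategory) (A B C : M)
    (f : M A B) (g : M B A) (f' : M B C) (g' : M C B)
    (e : f ⊙ g ⟶ id1 B) (e' : f' ⊙ g' ⟶ id1 C) (K : M) (x : M K C) :
  counit_at (comp_counit e e') x =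
  counit_at e' x ∘ (f' ◁ counit_at e (g' ⊙ x)) ∘ (f' ◁ (f ◁ assoc g g' x))
    ∘ assoc f' f ((g ⊙ g') ⊙ x).
Proof.
apply: (iso_cancel_r (i := assoc (f' ⊙ f) (g ⊙ g') x)).
rewrite {1}/counit_at !comp_assoc bwd_fwd comp_idr /comp_counit pentagon.
rewrite !rwhisker_comp.
have E : lunit x ∘ (e' ▷ x) = counit_at e' x ∘ assoc f' g' x.
  by rewrite /counit_at !comp_assoc bwd_fwd comp_idr.
rewrite -(comp_assoc (lunit x)) E comp_assoc.
rewrite -(comp_assoc (assoc f' g' x)) assoc_natural -counit_at_comp1.
by rewrite !lwhisker_comp !comp_assoc.
Qed.

Lemma unit_at_comp_unit (M : Bicategory) (A B C : M)
    (f : M A B) (g : M B A) (f' : M B C) (g' : M C B)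
    (n : id1 A ⟶ g ⊙ f) (n' : id1 B ⟶ g' ⊙ f') (K : M) (w : M K A) :
  (g ◁ (g' ◁ assoc f' f w)) ∘ assoc g g' ((f' ⊙ f) ⊙ w)
    ∘ unit_at (comp_unit n n') w
  = (g ◁ unit_at n' (f ⊙ w)) ∘ unit_at n w.
Proof.
apply: (iso_cancel_r (i := lunit w)).
rewrite /unit_at -/(unit_at n' (f ⊙ w)) !comp_assoc bwd_fwd !comp_idr.
rewrite -(comp_assoc (assoc g g' _)) pentagon !comp_assoc -rwhisker_comp.
rewrite /comp_unit fwd_bwdK rwhisker_comp.
rewrite -[assoc g (g' ⊙ _) w ∘ _]comp_assoc assoc_natural -unit_at_comp1.
by rewrite !lwhisker_comp !comp_assoc.
Qed.

Lemma counit_at_adj_unit (M : Bicategory) (A B : M) (f : M A B) (g : M B A)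
    (a : Adjunction f g) :
  counit_at (adj_counit a) f ∘ (f ◁ adj_unit a) = runit f.
Proof. by rewrite -(adj_triangle_l a) /counit_at !comp_assoc. Qed.

Lemma unit_at_adj_counit (M : Bicategory) (A B : M) (f : M A B) (g : M B A)
    (a : Adjunction f g) :
  runit g ∘ (g ◁ adj_counit a) ∘ unit_at (adj_unit a) g = idm g.
Proof.
apply: (iso_cancel_r (i := lunit g)).
by rewrite /unit_at !comp_assoc bwd_fwd comp_idr comp_idl adj_triangle_r.
Qed.

Lemma comp_triangle_l (M : Bicategory) (A B C : M)
    (f : M A B) (g : M B A) (f' : M B C) (g' : M C B)
    (a : Adjunction f g) (a' : Adjunction f' g') :
  counit_at (comp_counit (adj_counit a) (adj_counit a')) (f' ⊙ f)
    ∘ ((f' ⊙ f) ◁ comp_unit (adj_unit a) (adj_unit a'))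
  = runit (f' ⊙ f).
Proof.
have E : (f ◁ assoc g g' (f' ⊙ f))
           ∘ (f ◁ comp_unit (adj_unit a) (adj_unit a'))
         = (f ◁ (g ◁ unit_at (adj_unit a') f)) ∘ (f ◁ adj_unit a).
  by rewrite -!lwhisker_comp /comp_unit fwd_bwdK.
rewrite counit_at_comp_counit.
rewrite comp_assoc 2!(comp_assoc (f' ◁ _)) -(comp2_id f' f) assoc_natural.
rewrite -(comp_assoc (f' ◁ _) (f' ◁ _)) -lwhisker_comp.
rewrite -(comp_assoc (f' ◁ _) (f' ◁ _)) -lwhisker_comp.
rewrite (comp_assoc (counit_at _ _)) E.
rewrite -(comp_assoc (counit_at (adj_counit a) _)) counit_at_natural.
rewrite (comp_assoc _ (counit_at _ _)).
rewrite counit_at_adj_unit.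
rewrite lwhisker_comp -!comp_assoc counit_at_unit_at comp_idl.
by rewrite runit_comp1.
Qed.

Lemma comp_triangle_r (M : Bicategory) (A B C : M)
    (f : M A B) (g : M B A) (f' : M B C) (g' : M C B)
    (a : Adjunction f g) (a' : Adjunction f' g') :
  runit (g ⊙ g')
    ∘ ((g ⊙ g') ◁ comp_counit (adj_counit a) (adj_counit a'))
    ∘ unit_at (comp_unit (adj_unit a) (adj_unit a')) (g ⊙ g')
  = idm (g ⊙ g').
Proof.
have E : g ◁ (g' ◁ comp_counit (adj_counit a) (adj_counit a'))
  = (g ◁ (g' ◁ adj_counit a'))
      ∘ (g ◁ (g' ◁ (f' ◁ counit_at (adj_counit a) g')))
      ∘ (g ◁ (g' ◁ assoc f' f (g ⊙ g'))).
  by rewrite -!lwhisker_comp.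
rewrite -runit_comp1 !comp_assoc -(comp2_id g g').
rewrite -(comp_assoc (assoc g g' _)) assoc_natural E.
rewrite !(comp_assoc (g ◁ (g' ◁ _))) unit_at_comp_unit.
rewrite -(comp_assoc (g ◁ (g' ◁ (f' ◁ _)))) -lwhisker_comp -unit_at_natural.
rewrite (lwhisker_comp g (unit_at _ _)) (comp_assoc (g ◁ unit_at _ _)).
rewrite unit_at_counit_at comp_idr -!lwhisker_comp.
by rewrite unit_at_adj_counit !comp2_id.
Qed.

Definition adjunction_comp (M : Bicategory) (A B C : M)
    (f : M A B) (g : M B A) (f' : M B C) (g' : M C B)
    (a : Adjunction f g) (a' : Adjunction f' g') :
  Adjunction (f' ⊙ f) (g ⊙ g').
Proof.
refine {| adj_unit := comp_unit (adj_unit a) (adj_unit a');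
          adj_counit := comp_counit (adj_counit a) (adj_counit a') |}.
- by rewrite -(comp_triangle_l a a') /counit_at !comp_assoc.
- have /(comp_eq (lunit (g ⊙ g'))) := comp_triangle_r a a'.
  by rewrite /unit_at !comp_assoc bwd_fwd comp_idr comp_idl.
Defined.

Definition adjunction_id (M : Bicategory) (A : M) : Adjunction (id1 A) (id1 A).
Proof.
refine {| adj_unit := bwd (lunit (id1 A)); adj_counit := lunit (id1 A) |}.
- have E : lunit (id1 A) ▷ id1 A
           = (id1 A ◁ lunit (id1 A)) ∘ assoc (id1 A) (id1 A) (id1 A).
    by rewrite triangle lunit_id1.
  rewrite E !comp_assoc fwd_bwdK -lwhisker_comp fwd_bwd comp2_id comp_idr.
  by rewrite lunit_id1.
- rewrite -(comp_assoc (id1 A ◁ _)) triangle -lunit_id1 -rwhisker_comp.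
  by rewrite fwd_bwd comp2_id comp_idr.
Defined.

Lemma is_left_adjoint_comp (M : Bicategory) (A B C : M)
    (f' : M B C) (f : M A B) :
  is_left_adjoint f' -> is_left_adjoint f -> is_left_adjoint (f' ⊙ f).
Proof.
move=> [g' [a']] [g [a]]; exists (g ⊙ g'); split; exact: adjunction_comp.
Qed.

Lemma is_left_adjoint_id (M : Bicategory) (A : M) : is_left_adjoint (id1 A).
Proof. by exists (id1 A); split; exact: adjunction_id. Qed.

(** * Tabulations from the terminal *)

Definition full_subcategory_iso (C : Category) (P : C -> Prop)
    (x y : full_subcategory P) (i : Iso (proj1_sig x) (proj1_sig y)) :
  Iso x y :=
  @Build_Iso (full_subcategory P) x y (fwd i) (bwd i) (fwd_bwd i) (bwd_fwd i).

(** The hom-categories of the sub-bicategory [M_*]: left adjoint morphisms and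
    all 2-cells between them. *)
Definition left_adjoint_hom (M : Bicategory) (A B : M) : Category :=
  full_subcategory (@is_left_adjoint M A B).

Definition left_adjoint_id (M : Bicategory) (A : M) : left_adjoint_hom A A :=
  exist _ (id1 A) (is_left_adjoint_id A).

Definition left_adjoint_comp (M : Bicategory) (A B C : M)
    (g : left_adjoint_hom B C) (f : left_adjoint_hom A B) :
  left_adjoint_hom A C :=
  exist _ (proj1_sig g ⊙ proj1_sig f)
    (is_left_adjoint_comp (proj2_sig g) (proj2_sig f)).

Definition left_adjoints (M : Bicategory) : Bicategory.
Proof.
refine {|
  bob := M;
  bhom := @left_adjoint_hom M;
  id1 := @left_adjoint_id M;
  comp1 := @left_adjoint_comp M;
  comp2 := fun A B C g g' f f' b a =>
    comp2 (b := M) (g := proj1_sig g) (g' := proj1_sig g')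
          (f := proj1_sig f) (f' := proj1_sig f') b a;
  assoc := fun A B C D h g f => full_subcategory_iso
    (x := left_adjoint_comp (left_adjoint_comp h g) f)
    (y := left_adjoint_comp h (left_adjoint_comp g f))
    (assoc (proj1_sig h) (proj1_sig g) (proj1_sig f));
  lunit := fun A B f => full_subcategory_iso
    (x := left_adjoint_comp (left_adjoint_id B) f) (lunit (proj1_sig f));
  runit := fun A B f => full_subcategory_iso
    (x := left_adjoint_comp f (left_adjoint_id A)) (runit (proj1_sig f)) |}.
- by move=> *; apply: comp2_id.
- by move=> *; apply: comp2_comp.
- by move=> *; apply: assoc_natural.
- by move=> *; apply: lunit_natural.
- by move=> *; apply: runit_natural.
- by move=> *; apply: pentagon.
- by move=> *; apply: triangle.
Defined.

(** A terminal object [1] of [M_*] whose left adjoint morphisms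
    [bang U = !_U] into it are terminal in [M(U, 1)]. *)
Record TerminalData (M : Bicategory) := {
  one : M;
  one_terminal : is_bicategorical_terminal (M := left_adjoints M) one;
  bang : forall U : M, left_adjoints M U one;
  bang_terminal : forall U : M, Terminal (proj1_sig (bang U) : M U one)
}.

Definition bang1 (M : Bicategory) (T : TerminalData M) (U : M) : M U (one T) :=
  proj1_sig (bang T U).

(** The 2-cell [p w ⟶ (u !_U) w ⟶ u (!_U w) ⟶ u !_K]. *)
Definition tabulation_cell (M : Bicategory) (T : TerminalData M) (X : M)
    (u : M (one T) X) (U : M) (p : M U X) (rho : p ⟶ u ⊙ bang1 T U)
    (K : M) (w : M K U) : p ⊙ w ⟶ u ⊙ bang1 T K :=
  (u ◁ to_terminal (bang_terminal T K) (bang1 T U ⊙ w))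
    ∘ assoc u (bang1 T U) w ∘ (rho ▷ w).

Lemma tabulation_cell_natural (M : Bicategory) (T : TerminalData M) (X : M)
    (u : M (one T) X) (U : M) (p : M U X) (rho : p ⟶ u ⊙ bang1 T U)
    (K : M) (v w : M K U) (s : v ⟶ w) :
  tabulation_cell rho w ∘ fmap (postcomp K p) s = tabulation_cell rho v.
Proof.
rewrite /tabulation_cell /= !comp_assoc whisker_exchange.
rewrite -(comp_assoc (assoc _ _ _)) -comp2_id assoc_natural -!comp_assoc.
rewrite -lwhisker_comp; congr (((u ◁ _) ∘ _) ∘ _).
exact: (to_terminal_unique (bang_terminal T K)).
Qed.

Definition is_tabulation (M : Bicategory) (T : TerminalData M) (X : M)
    (u : M (one T) X) (U : M) (p : M U X) (rho : p ⟶ u ⊙ bang1 T U) : Prop :=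
  is_left_adjoint p /\
  forall K : M,
    is_equivalence_of_categories
      (functor_to_slice (F := postcomp K p) (c := u ⊙ bang1 T K)
         (lam := @tabulation_cell M T X u U p rho K)
         (@tabulation_cell_natural M T X u U p rho K)).

Record TabulationsFromTerminal (M : Bicategory) := {
  terminal_data :> TerminalData M;
  has_tabulations : forall (X : M) (u : M (one terminal_data) X),
    exists (U : M) (p : M U X) (rho : p ⟶ u ⊙ bang1 terminal_data U),
      is_tabulation rho
}.

(** * Calibrations *)

Definition MorphismClass (M : Bicategory) : Type :=
  forall A B : M, M A B -> Prop.

Definition Tab (M : Bicategory) (T : TabulationsFromTerminal M) :
  MorphismClass M :=
  fun U X p => exists (u : M (one T) X) (rho : p ⟶ u ⊙ bang1 T U),
    is_tabulation rho.

Definition postcomp_square_iso (M : Bicategory) (P A B C : M) (n : M A C)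
    (p : M B C) (d : M P A) (c : M P B) (th : Iso (n ⊙ d) (p ⊙ c))
    (K : M) (u : M K P) : Iso (n ⊙ (d ⊙ u)) (p ⊙ (c ⊙ u)) :=
  iso_comp (assoc p c u)
    (iso_comp (rwhisker_iso u th) (iso_inv (assoc n d u))).

Definition postcomp_square (M : Bicategory) (P A B C : M) (n : M A C)
    (p : M B C) (d : M P A) (c : M P B) (th : Iso (n ⊙ d) (p ⊙ c)) (K : M) :
  NatIso (functor_comp (postcomp K n) (postcomp K d))
         (functor_comp (postcomp K p) (postcomp K c)).
Proof.
exists (fun u : M K P => postcomp_square_iso th u).
move=> u v s /=; rewrite !comp_assoc -assoc_bwd_natural comp2_id.
rewrite -(comp_assoc (th ▷ v)) whisker_exchange !comp_assoc.
by rewrite -(comp2_id p c) -(comp_assoc (assoc p c v)) assoc_natural !comp_assoc.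
Defined.

(** [th : n d ≅ p c] exhibits [P], with projections [d] and [c], as a
    bipullback of [(n, p)]. *)
Definition is_bipullback (M : Bicategory) (P A B C : M) (n : M A C)
    (p : M B C) (d : M P A) (c : M P B) (th : Iso (n ⊙ d) (p ⊙ c)) : Prop :=
  forall K : M,
    is_equivalence_of_categories
      (functor_to_pseudo_comma (postcomp_square th K)).

Definition is_groupoid_fibration (M : Bicategory) (E B : M) (p : M E B) : Prop :=
  forall K : M, is_groupoid_fibration_of_categories (postcomp K p).

Definition is_right_lifter (M : Bicategory) (Y Z : M) (n : M Y Z) : Prop :=
  forall (K : M) (u : M K Z),
    exists (r : M K Y) (pi : n ⊙ r ⟶ u),
      forall (v : M K Y) (t : n ⊙ v ⟶ u),
        exists! s : v ⟶ r, pi ∘ (n ◁ s) = t.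

Record is_calibration (M : Bicategory) (P : MorphismClass M) : Prop := {
  calibration_equivalence : forall (A B : M) (f : M A B),
    is_equivalence f -> P A B f;
  calibration_iso : forall (A B : M) (f g : M A B),
    inhabited (Iso f g) -> P A B f -> P A B g;
  calibration_comp : forall (A B C : M) (p : M B C) (q : M A B),
    P B C p -> (P A C (p ⊙ q) <-> P A B q);
  calibration_groupoid_fibration : forall (A B : M) (p : M A B),
    P A B p -> is_groupoid_fibration p;
  calibration_bipullback : forall (S T Y : M) (p : M S Y) (n : M T Y),
    is_right_lifter n -> P S Y p ->
    exists (Q : M) (n' : M Q S) (p' : M Q T) (th : Iso (n ⊙ p') (p ⊙ n')),
      is_bipullback th /\ P Q T p'
}.

(* Main.v *)
From Stdlib Require Import ssreflect IndefiniteDescription.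
Require Import Defs.

(** The class [Tab] consists of all groupoid fibrations. Indeed the projection of
    a slice category is a groupoid fibration. Conversely, let [p : U ⟶ X] be a
    groupoid fibration and [!^*] a right adjoint of [!_U]: as [!^* !_K] is terminal
    in [M(K, U)], the functor [M(K, p)] identifies [M(K, U)] with the slice of
    [M(K, X)] over [p !^* !_K]. So [p] agrees, up to an equivalence, with the right
    leg of a tabulation of [p !^*]; in particular it is a left adjoint and in [Tab].

    The closure properties then reduce to those of groupoid fibrations. For the
    bipullback of [n] and [p], where [p] tabulates [u], tabulate the right lifting
    [r] of [u] through [n]: because [!_K] is a left adjoint, [r !_K] is the right
    lifting of [u !_K] through [n], so the slice of [M(K, T)] over [r !_K] is the
    pullback along [M(K, n)] of the slice over [u !_K]. *)

Set Implicit Arguments.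
Unset Strict Implicit.
Unset Printing Implicit Defensive.

Local Open Scope bicat_scope.

(** * Functors and slices *)

Definition is_fully_faithful (C D : Category) (F : Functor C D) : Prop :=
  forall (x y : C) (b : F x ⟶ F y), exists! s : x ⟶ y, fmap F s = b.

Definition is_essentially_surjective (C D : Category) (F : Functor C D) : Prop :=
  forall d : D, exists x : C, inhabited (Iso (F x) d).

Lemma fully_faithful_inj (C D : Category) (F : Functor C D) :
  is_fully_faithful F ->
  forall (x y : C) (s s' : x ⟶ y), fmap F s = fmap F s' -> s = s'.
Proof.
move=> ff x y s s' e; have [u [_ U]] := ff _ _ (fmap F s').
by rewrite -(U s e) -(U s').
Qed.

Lemma inhabited_witness (A : Type) : inhabited A -> A.
Proof.
move=> h; suff [a _] : {a : A | True} by exact: a.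
by apply: constructive_indefinite_description; case: h => a; exists a.
Qed.

(** From right to left, choice selects a preimage of each object up to isomorphism; full
    faithfulness then determines the inverse on morphisms and gives its laws. *)
Lemma is_equivalence_of_categoriesP (C D : Category) (F : Functor C D) :
  is_equivalence_of_categories F <->
  is_essentially_surjective F /\ is_fully_faithful F.
Proof.
split.
- move=> [G [[a] [b]]].
  have natG x y (s : x ⟶ y) : s = a y ∘ fmap G (fmap F s) ∘ bwd (a x).
    by rewrite -comp_assoc (natiso_natural a) comp_assoc fwd_bwd comp_idr.
  have natF x y (t : x ⟶ y) : t = b y ∘ fmap F (fmap G t) ∘ bwd (b x).
    by rewrite -comp_assoc (natiso_natural b) comp_assoc fwd_bwd comp_idr.
  split=> [d|x y t]; first by exists (G d); split; exact: b.
  exists (a y ∘ fmap G t ∘ bwd (a x)); split; last first.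
    by move=> s <-; rewrite -natG.
  (* The isomorphisms [a] and [b] may violate the triangle identities. By [natF] it suffices to
     compare images under [G], and these agree by [natG]. *)
  rewrite [LHS]natF [RHS]natF; congr (_ ∘ fmap F _ ∘ _).
  apply: (iso_cancel_l (i := a y)); apply: (iso_cancel_r (i := iso_inv (a x))).
  by rewrite /= !comp_assoc -natG.
- move=> [es ff].
  have /(fun f d => inhabited_witness (f d)) G0 :
      forall d : D, inhabited {x : C & Iso (F x) d}.
    by move=> d; have [x [i]] := es d; split; exists x.
  pose i d := projT2 (G0 d).
  have G1 x y (t : F x ⟶ F y) : {s : x ⟶ y | fmap F s = t}.
    apply: constructive_indefinite_description.
    by have [s [e _]] := ff _ _ t; exists s.
  have inj := fully_faithful_inj ff.
  pose g d d' (t : d ⟶ d') := proj1_sig (G1 _ _ (bwd (i d') ∘ t ∘ i d)).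
  have gE d d' (t : d ⟶ d') : fmap F (g _ _ t) = bwd (i d') ∘ t ∘ i d.
    exact: (proj2_sig (G1 _ _ _)).
  unshelve eexists {| fobj := fun d => projT1 (G0 d) : C; fmap := g |}.
  + by move=> d; apply: inj; rewrite gE fmap_id comp_idl bwd_fwd.
  + move=> d d' d'' t s; apply: inj.
    by rewrite fmap_comp !gE !comp_assoc fwd_bwdK.
  + split; split; last first.
      by exists i => d d' t /=; rewrite gE fwd_bwdK.
    unshelve eexists (fun x => Build_Iso (fwd := proj1_sig (G1 _ x (i (F x))))
      (bwd := proj1_sig (G1 x _ (bwd (i (F x))))) _ _).
    * by apply: inj; rewrite fmap_comp !(proj2_sig (G1 _ _ _)) fwd_bwd fmap_id.
    * by apply: inj; rewrite fmap_comp !(proj2_sig (G1 _ _ _)) bwd_fwd fmap_id.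
    * move=> x y s /=; apply: inj.
      by rewrite !fmap_comp gE !(proj2_sig (G1 _ _ _)) fwd_bwdK.
Qed.

(** Essential surjectivity and full faithfulness of the functor into the slice over [c], phrased in
    [D] to avoid dependent pairs. *)
Definition is_slice_like (C D : Category) (F : Functor C D) (c : D)
    (lam : forall x, F x ⟶ c) : Prop :=
  (forall (d : D) (a : d ⟶ c), exists (x : C) (i : Iso (F x) d), a ∘ i = lam x) /\
  (forall (x y : C) (b : F x ⟶ F y), lam y ∘ b = lam x ->
     exists! s : x ⟶ y, fmap F s = b).

Lemma functor_to_slice_equivalenceP (C D : Category) (F : Functor C D) (c : D)
    (lam : forall x, F x ⟶ c)
    (lam_nat : forall x y (f : x ⟶ y), lam y ∘ fmap F f = lam x) :
  is_equivalence_of_categories (functor_to_slice lam_nat) <-> is_slice_like lam.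
Proof.
rewrite is_equivalence_of_categoriesP; split=> -[es ff]; split.
- move=> d a; have [x [[[f ef] [g eg] fg gf]]] := es (existT _ d a).
  have /= efg := f_equal (@proj1_sig _ _) fg.
  have /= egf := f_equal (@proj1_sig _ _) gf.
  by exists x, (Build_Iso efg egf).
- move=> x y b e.
  have [s [e' U]] := ff x y (exist _ b e); exists s; split.
    by have := f_equal (@proj1_sig _ _) e'.
  by move=> s' e''; apply: U; apply: sig_ext.
- move=> [d a]; have [x [i e]] := es d a; exists x; split.
  have e' : lam x ∘ bwd i = a by rewrite -e comp_assoc fwd_bwd comp_idr.
  unshelve eexists (exist _ (fwd i) e) (exist _ (bwd i) e').
  + by apply: sig_ext; rewrite /= fwd_bwd.
  + by apply: sig_ext; rewrite /= bwd_fwd.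
- move=> x y [b e]; have [s [e' U]] := ff x y b e; exists s; split.
    exact: sig_ext.
  by move=> s' e''; apply: U; have := f_equal (@proj1_sig _ _) e''.
Qed.

Lemma is_slice_like_target_iso (C D : Category) (F : Functor C D) (c c' : D)
    (lam : forall x, F x ⟶ c) (lam' : forall x, F x ⟶ c') (i : Iso c c') :
  (forall x, lam' x = i ∘ lam x) -> is_slice_like lam -> is_slice_like lam'.
Proof.
move=> E [es ff]; split.
- move=> d a; have [x [j e]] := es d (bwd i ∘ a); exists x, j.
  by rewrite E -e !comp_assoc fwd_bwdK.
- move=> x y b; rewrite !E comp_assoc => e; apply: ff.
  exact: (iso_cancel_l (i := i)).
Qed.

(** By naturality of [lam] every [fmap F s] lies over [c], so uniqueness of lifts gives faithfulness
    of [F]. *)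
Lemma slice_like_inj (C D : Category) (F : Functor C D) (c : D)
    (lam : forall x, F x ⟶ c) :
  (forall x y (f : x ⟶ y), lam y ∘ fmap F f = lam x) -> is_slice_like lam ->
  forall (x y : C) (s s' : x ⟶ y), fmap F s = fmap F s' -> s = s'.
Proof.
move=> nat [_ ff] x y s s' e; have [u [_ U]] := ff _ _ (fmap F s') (nat _ _ _).
by rewrite -(U s e) -(U s').
Qed.

Lemma slice_like_lift_iso (C D : Category) (F : Functor C D) (c : D)
    (lam : forall x, F x ⟶ c) :
  (forall x y (f : x ⟶ y), lam y ∘ fmap F f = lam x) -> is_slice_like lam ->
  forall (x y : C) (b : Iso (F x) (F y)), lam y ∘ b = lam x ->
  exists s : Iso x y, fmap F s = b.
Proof.
move=> nat sl x y b e.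
have [s [es _]] := proj2 sl _ _ _ e.
have [|t [et _]] := proj2 sl y x (bwd b).
  by rewrite -e comp_assoc fwd_bwd comp_idr.
unshelve eexists (Build_Iso (fwd := s) (bwd := t) _ _) => //.
- by apply: (slice_like_inj nat sl); rewrite fmap_comp fmap_id es et fwd_bwd.
- by apply: (slice_like_inj nat sl); rewrite fmap_comp fmap_id es et bwd_fwd.
Qed.

(** * Groupoid fibrations of categories *)

Lemma is_cartesianP (E B : Category) (p : Functor E B) (e' e : E)
    (chi : e' ⟶ e) :
  is_cartesian p chi <->
  forall (k : E) (a : k ⟶ e) (b : p k ⟶ p e'), fmap p a = fmap p chi ∘ b ->
    exists! s : k ⟶ e', chi ∘ s = a /\ fmap p s = b.
Proof.
split=> [h k|h k]; first exact: (proj2 (h k)).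
by split=> [x|]; [exact: fmap_comp | exact: h].
Qed.

(** Composing with [lam e] makes any [b ⟶ F e] a morphism over [c], which therefore lifts. *)
Lemma slice_like_groupoid_fibration (C D : Category) (F : Functor C D) (c : D)
    (lam : forall x, F x ⟶ c) :
  (forall x y (f : x ⟶ y), lam y ∘ fmap F f = lam x) -> is_slice_like lam ->
  is_groupoid_fibration_of_categories F.
Proof.
move=> nat sl; have inj := slice_like_inj nat sl; case: (sl) => es ff.
split=> [e b beta|e' e chi].
- have [x [i ei]] := es _ (lam e ∘ beta).
  rewrite comp_assoc in ei; have [chi [echi _]] := ff _ _ _ ei.
  by exists x, chi, (iso_inv i); rewrite echi comp_assoc fwd_bwd comp_idr.
- apply/is_cartesianP => k a b eab.
  have [|s [es' _]] := ff k e' b; first by rewrite -(nat _ _ chi) comp_assoc -eab nat.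
  exists s; split; last by move=> s' [_ e2]; apply: inj; rewrite e2.
  by split=> //; apply: inj; rewrite fmap_comp es'.
Qed.

(** A groupoid fibration restricts to equivalences on slices; the slice of [C]
    over a terminal object is [C]. *)
Lemma groupoid_fibration_slice_like (C D : Category) (F : Functor C D) (t : C)
    (T : Terminal t) :
  is_groupoid_fibration_of_categories F ->
  is_slice_like (F := F) (fun x => fmap F (to_terminal T x)).
Proof.
move=> [lift cart]; split.
- move=> d a; have [x [chi [i e]]] := lift _ _ a; exists x, (iso_inv i).
  rewrite -e comp_assoc fwd_bwd comp_idr; congr (fmap F _).
  exact: to_terminal_unique.
- move=> x y b e.
  have /is_cartesianP/(_ _ _ _ (eq_sym e)) [s [[_ es] U]] := cart _ _ (to_terminal T y).
  exists s; split=> // s' es'; apply: U; split=> //; exact: to_terminal_unique.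
Qed.

Lemma groupoid_fibration_natiso (C D : Category) (F G : Functor C D) :
  NatIso F G -> is_groupoid_fibration_of_categories F ->
  is_groupoid_fibration_of_categories G.
Proof.
move=> i [lift cart]; split.
- move=> e b beta; have [e' [chi [j ej]]] := lift _ _ (bwd (i e) ∘ beta).
  exists e', chi, (iso_comp (i e') j).
  by rewrite /= -comp_assoc -(natiso_natural i) comp_assoc ej fwd_bwdK.
- move=> e' e chi; apply/is_cartesianP => k a b eab.
  have eF : fmap F a = fmap F chi ∘ bwd (i e') ∘ b ∘ i k.
    apply: (iso_cancel_l (i := i e)).
    rewrite (natiso_natural i) eab -(comp_assoc (i e)) (natiso_natural i).
    by rewrite !comp_assoc fwd_bwdK.
  have /is_cartesianP/(_ _ _ _ eF) [s [[e1 e2] U]] := cart _ _ chi.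
  exists s; split.
    split=> //; apply: (iso_cancel_r (i := i k)).
    by rewrite -(natiso_natural i) e2 fwd_bwdK.
  move=> s' [e1' e2']; apply: U; split=> //.
  by apply: (iso_cancel_l (i := i e')); rewrite natiso_natural e2' fwd_bwdK.
Qed.

Lemma groupoid_fibration_comp (C D E : Category) (G : Functor D E)
    (F : Functor C D) :
  is_groupoid_fibration_of_categories G ->
  is_groupoid_fibration_of_categories F ->
  is_groupoid_fibration_of_categories (functor_comp G F).
Proof.
move=> [liftG cartG] [liftF cartF]; split.
- move=> e b beta; have [d [chi [i ei]]] := liftG (F e) b beta.
  have [c [xi [j ej]]] := liftF _ _ chi.
  have eq1 : fmap G j ∘ fmap G (bwd j) = idm _.
    by rewrite -fmap_comp fwd_bwd fmap_id.
  have eq2 : fmap G (bwd j) ∘ fmap G j = idm _.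
    by rewrite -fmap_comp bwd_fwd fmap_id.
  exists c, xi, (iso_comp (Build_Iso eq1 eq2) i) => /=.
  by rewrite -comp_assoc -fmap_comp ej.
- move=> e' e chi; apply/is_cartesianP => k a b /= eab.
  have /is_cartesianP/(_ _ _ _ eab) [s [[e1 e2] U]] := cartG _ _ (fmap F chi).
  have /is_cartesianP/(_ _ _ _ (eq_sym e1)) [r [[f1 f2] V]] := cartF _ _ chi.
  exists r; split; first by rewrite f2.
  move=> r' [g1 g2]; apply: V; split=> //.
  by rewrite -(U (fmap F r')) // -fmap_comp g1.
Qed.

(** Lift [fmap G beta] along the composite to [chi]. Then [fmap F chi] and [beta] are both
    [G]-cartesian over the same morphism up to [i], hence isomorphic. *)
Lemma groupoid_fibration_cancel (C D E : Category) (G : Functor D E)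
    (F : Functor C D) :
  is_groupoid_fibration_of_categories G ->
  is_groupoid_fibration_of_categories (functor_comp G F) ->
  is_groupoid_fibration_of_categories F.
Proof.
move=> [liftG cartG] [lift cart]; split.
- move=> e b beta; have [e' [chi [i ei]]] := lift e (G b) (fmap G beta).
  have /is_cartesianP/(_ _ _ _ (eq_sym ei)) [s [[e1 e2] _]] := cartG _ _ (fmap F chi).
  have ei' : fmap G (fmap F chi) = fmap G beta ∘ bwd i.
    by rewrite -ei comp_assoc fwd_bwd comp_idr.
  have /is_cartesianP/(_ _ _ _ ei') [t [[f1 f2] _]] := cartG _ _ beta.
  (* Both [x] and the identity factor the cartesian [c] through itself over the identity. *)
  have uniq d d' (c : d' ⟶ d) (x : d' ⟶ d') : c ∘ x = c ->
      fmap G x = idm _ -> x = idm _.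
    move=> h1 h2; have := proj1 (is_cartesianP _ _) (cartG _ _ c) _ c (idm _).
    rewrite comp_idr => /(_ eq_refl) [y [_ U]].
    by rewrite -(U x) // -(U (idm _)) // comp_idr fmap_id.
  have st : s ∘ t = idm _.
    apply: (uniq _ _ (fmap F chi)).
      by rewrite -comp_assoc e1 f1.
    by rewrite fmap_comp e2 f2 fwd_bwd.
  have ts : t ∘ s = idm _.
    apply: (uniq _ _ beta); first by rewrite -comp_assoc f1 e1.
    by rewrite fmap_comp e2 f2 bwd_fwd.
  by exists e', chi, (Build_Iso st ts).
- move=> e' e chi; apply/is_cartesianP => k a b eab.
  have eG : fmap (functor_comp G F) a = fmap (functor_comp G F) chi ∘ fmap G b.
    by rewrite /= eab fmap_comp.
  have /is_cartesianP/(_ _ _ _ eG) [s [[e1 e2] U]] := cart _ _ chi.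
  exists s; split; last by move=> s' [f1 f2]; apply: U; rewrite /= f2.
  (* Both [fmap F s] and [b] factor [fmap F a] through the cartesian [fmap F chi] over [fmap G b],
     so they agree. *)
  have eG' : fmap G (fmap F a) = fmap G (fmap F chi) ∘ fmap G b := eG.
  have /is_cartesianP/(_ _ _ _ eG') [t [_ V]] := cartG _ _ (fmap F chi).
  split=> //; transitivity t; last by apply: V; rewrite eab.
  by symmetry; apply: V; rewrite -fmap_comp e1.
Qed.

Lemma equivalence_groupoid_fibration (C D : Category) (F : Functor C D) :
  is_essentially_surjective F -> is_fully_faithful F ->
  is_groupoid_fibration_of_categories F.
Proof.
move=> es ff; split.
- move=> e b beta; have [e' [i]] := es b.
  have [chi [echi _]] := ff _ _ (beta ∘ i).
  by exists e', chi, (iso_inv i); rewrite echi comp_assoc fwd_bwd comp_idr.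
- move=> e' e chi; apply/is_cartesianP => k a b eab.
  have [s [e1 _]] := ff _ _ b; exists s; split.
    by split=> //; apply: (fully_faithful_inj ff); rewrite fmap_comp e1.
  by move=> s' [_ e2]; apply: (fully_faithful_inj ff); rewrite e2.
Qed.

(** * Adjunctions and equivalences in a bicategory *)

(** The unit is the transpose of [runit f], which is the first triangle identity. The second is
    checked after transposing, where it reduces to the first. *)
Lemma right_adjoint_of_universal_counit (M : Bicategory) (A B : M) (f : M A B)
    (g : M B A) (e : f ⊙ g ⟶ id1 B) :
  (forall (K : M) (w : M K A) (x : M K B) (t : f ⊙ w ⟶ x),
     exists! s : w ⟶ g ⊙ x, counit_at e x ∘ (f ◁ s) = t) ->
  inhabited (Adjunction f g).
Proof.
move=> univ.
have inj (K : M) (w : M K A) (x : M K B) (s s' : w ⟶ g ⊙ x) :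
    counit_at e x ∘ (f ◁ s) = counit_at e x ∘ (f ◁ s') -> s = s'.
  move=> E; have [u [_ U]] := univ _ _ _ (counit_at e x ∘ (f ◁ s')).
  by rewrite -(U s E) -(U s').
have [n [en _]] := univ _ _ _ (fwd (runit f)).
have tri_l : lunit f ∘ (e ▷ f) ∘ bwd (assoc f g f) ∘ (f ◁ n) = runit f.
  by rewrite -en /counit_at !comp_assoc.
have counitE : counit_at e (id1 B) ∘ (f ◁ bwd (runit g)) = e.
  apply: (iso_cancel_r (i := runit (f ⊙ g))).
  rewrite -runit_comp1 comp_assoc -[(f ◁ bwd _) ∘ _]comp_assoc -lwhisker_comp.
  rewrite bwd_fwd comp2_id comp_idl /counit_at !comp_assoc bwd_fwd comp_idr.
  by rewrite lunit_id1 runit_natural runit_comp1.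
split; apply: (Build_Adjunction tri_l).
apply: (iso_cancel_l (i := iso_inv (runit g))) => /=.
rewrite -comp_assoc bwd_fwd comp_idl; apply: inj.
rewrite (lwhisker_comp f (bwd _)) -(comp_assoc (counit_at _ _)) counitE.
rewrite lwhisker_comp -(comp_assoc (counit_at _ _)) counit_at_natural comp_assoc.
congr (e ∘ _).
apply: (iso_cancel_r (i := assoc f (id1 A) g)).
rewrite triangle -en rwhisker_comp -counit_at_comp1 lwhisker_comp !comp_assoc.
by rewrite assoc_natural.
Qed.

Lemma is_left_adjoint_iso (M : Bicategory) (A B : M) (f f' : M A B) :
  Iso f f' -> is_left_adjoint f -> is_left_adjoint f'.
Proof.
move=> i [g [a]]; exists g.
apply: (right_adjoint_of_universal_counit (e := adj_counit a ∘ (bwd i ▷ g))).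
move=> K w x t.
(* Transposition for [f'] is transposition for [f] followed by the isomorphism [bwd i ▷ w]. *)
have E s : counit_at (adj_counit a ∘ (bwd i ▷ g)) x ∘ (f' ◁ s) =
    counit_at (adj_counit a) x ∘ (f ◁ s) ∘ (bwd i ▷ w).
  rewrite /counit_at rwhisker_comp !comp_assoc -(comp_assoc ((bwd i ▷ g) ▷ x)).
  by rewrite assoc_bwd_natural comp2_id -whisker_exchange !comp_assoc.
exists ((g ◁ (t ∘ (i ▷ w))) ∘ unit_at (adj_unit a) w); split.
  rewrite E lwhisker_comp (comp_assoc (f ◁ _)) -(comp_assoc (counit_at _ _)).
  rewrite counit_at_natural (comp_assoc _ (counit_at _ _)).
  rewrite -(comp_assoc (counit_at _ _)) counit_at_unit_at comp_idl comp_assoc.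
  by have /= -> := fwd_bwd (rwhisker_iso w i); rewrite comp_idr.
move=> s; rewrite E => <-; rewrite (comp_assoc (counit_at _ _)) (comp_assoc (f ◁ s)).
have /= -> := bwd_fwd (rwhisker_iso w i); rewrite comp_idr.
rewrite lwhisker_comp (comp_assoc (g ◁ _)) -unit_at_natural -comp_assoc.
by rewrite unit_at_counit_at comp_idl.
Qed.

Definition counit_at_iso (M : Bicategory) (A B : M) (f : M A B) (g : M B A)
    (i : Iso (f ⊙ g) (id1 B)) (K : M) (x : M K B) : Iso (f ⊙ (g ⊙ x)) x :=
  iso_comp (lunit x) (iso_comp (rwhisker_iso x i) (iso_inv (assoc f g x))).

Lemma counit_at_isoE (M : Bicategory) (A B : M) (f : M A B) (g : M B A)
    (i : Iso (f ⊙ g) (id1 B)) (K : M) (x : M K B) :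
  fwd (counit_at_iso i x) = counit_at i x.
Proof. by []. Qed.

Lemma retract_postcomp_inj (M : Bicategory) (A B : M) (f : M A B) (g : M B A)
    (i : Iso (g ⊙ f) (id1 A)) (K : M) (w w' : M K A) (s s' : w ⟶ w') :
  f ◁ s = f ◁ s' -> s = s'.
Proof.
move=> E; apply: (iso_cancel_r (i := counit_at_iso i w)).
by rewrite counit_at_isoE -!counit_at_natural E.
Qed.

Lemma equivalence_essentially_surjective (M : Bicategory) (A B : M) (f : M A B)
    (K : M) :
  is_equivalence f -> is_essentially_surjective (postcomp K f).
Proof.
move=> [g [_ [j]]] x; exists (g ⊙ x); split; exact: (counit_at_iso j x).
Qed.

Lemma equivalence_fully_faithful (M : Bicategory) (A B : M) (f : M A B) (K : M) :
  is_equivalence f -> is_fully_faithful (postcomp K f).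
Proof.
move=> [g [[i] [j]]] w w' t /=.
exists (counit_at_iso i w' ∘ (g ◁ t) ∘ bwd (counit_at_iso i w)); split.
  (* Whiskering by [g] is faithful because [f ⊙ g] is isomorphic to the identity. *)
  apply: (retract_postcomp_inj j).
  apply: (iso_cancel_l (i := counit_at_iso i w')).
  rewrite counit_at_isoE counit_at_natural -counit_at_isoE.
  by rewrite (comp_assoc (fwd _)) (comp_assoc (g ◁ t)) bwd_fwd comp_idr.
move=> s <-; rewrite -comp_assoc counit_at_isoE counit_at_natural -counit_at_isoE.
by rewrite (comp_assoc s) fwd_bwd comp_idr.
Qed.

(** The given isomorphisms may fail the triangle identities: [j] is kept as counit, and full
    faithfulness determines the unit. *)
Lemma equivalence_is_left_adjoint (M : Bicategory) (A B : M) (f : M A B) :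
  is_equivalence f -> is_left_adjoint f.
Proof.
move=> eqf; case: (eqf) => g [_ [j]]; exists g.
apply: (right_adjoint_of_universal_counit (e := j)) => K w x t.
rewrite -counit_at_isoE.
have [s [es U]] := equivalence_fully_faithful eqf (bwd (counit_at_iso j x) ∘ t).
exists s; split; first by rewrite /= in es; rewrite es fwd_bwdK.
by move=> s' e; apply: U; rewrite -e bwd_fwdK.
Qed.

(** * Universal cells *)

(** A tabulation without left adjointness of [p], which for groupoid fibrations is deduced only
    afterwards. *)
Definition is_universal_cell (M : Bicategory) (T : TerminalData M) (X : M)
    (u : M (one T) X) (U : M) (p : M U X)
    (rho : p ⟶ u ⊙ bang1 T U) : Prop :=
  forall K : M, is_slice_like (F := postcomp K p) (@tabulation_cell M T X u U p rho K).

Lemma is_tabulationP (M : Bicategory) (T : TerminalData M) (X : M)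
    (u : M (one T) X) (U : M) (p : M U X)
    (rho : p ⟶ u ⊙ bang1 T U) :
  is_tabulation rho <-> is_left_adjoint p /\ is_universal_cell rho.
Proof.
by split=> -[la sl]; split=> // K;
   have := sl K; rewrite functor_to_slice_equivalenceP.
Qed.

Lemma tabulation_cell_whisker (M : Bicategory) (T : TerminalData M) (X : M)
    (u : M (one T) X) (U : M) (p q : M U X)
    (rho : p ⟶ u ⊙ bang1 T U) (b : q ⟶ p) (K : M) (w : M K U) :
  tabulation_cell (rho ∘ b) w = tabulation_cell rho w ∘ (b ▷ w).
Proof. by rewrite /tabulation_cell rwhisker_comp !comp_assoc. Qed.

Lemma tabulation_cell_id (M : Bicategory) (T : TerminalData M) (X : M)
    (u : M (one T) X) (U : M) (p : M U X)
    (rho : p ⟶ u ⊙ bang1 T U) :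
  tabulation_cell rho (id1 U) = rho ∘ runit p.
Proof.
rewrite -runit_natural -runit_comp1 /tabulation_cell comp_assoc.
congr ((u ◁ _) ∘ _); exact: (to_terminal_unique (bang_terminal T U)).
Qed.

Lemma tabulation_cell_comp1 (M : Bicategory) (T : TerminalData M) (X : M)
    (u : M (one T) X) (U : M) (p : M U X)
    (rho : p ⟶ u ⊙ bang1 T U) (K L : M) (e : M K U) (w : M L K) :
  tabulation_cell (tabulation_cell rho e) w =
  tabulation_cell rho (e ⊙ w) ∘ assoc p e w.
Proof.
rewrite /tabulation_cell !rwhisker_comp !comp_assoc.
rewrite -(comp2_id e w) -assoc_natural -(comp_assoc (assoc u _ (e ⊙ w))) pentagon.
rewrite -(comp_assoc (assoc u _ w)) assoc_natural -!comp_assoc -!lwhisker_comp.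
congr ((((u ◁ _) ∘ _) ∘ _) ∘ _).
exact: (to_terminal_unique (bang_terminal T L)).
Qed.

(** The right adjoint functor [M(K, r)] preserves the terminal object [!_K]. *)
Definition bang_adjoint_terminal (M : Bicategory) (T : TerminalData M) (U : M)
    (r : M (one T) U) (a : Adjunction (bang1 T U) r) (K : M) :
  Terminal (r ⊙ bang1 T K : M K U).
Proof.
refine {| to_terminal := fun x : M K U =>
  (r ◁ to_terminal (bang_terminal T K) (bang1 T U ⊙ x)) ∘ unit_at (adj_unit a) x |}.
move=> x s s'.
rewrite -(comp_idl s) -(comp_idl s') -(unit_at_counit_at a) !(comp_assoc (r ◁ _)).
rewrite !unit_at_natural -!(comp_assoc (r ◁ _)) -!lwhisker_comp.
congr ((r ◁ _) ∘ _); exact: (to_terminal_unique (bang_terminal T K)).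
Qed.

Lemma groupoid_fibration_universal_cell (M : Bicategory) (T : TerminalData M)
    (X U : M) (p : M U X) :
  is_groupoid_fibration p ->
  exists (u : M (one T) X) (rho : p ⟶ u ⊙ bang1 T U), is_universal_cell rho.
Proof.
move=> fib; have [r [a]] := proj2_sig (bang T U); rewrite -/(bang1 T U) in a.
pose k K := bang_adjoint_terminal a K.
(* Up to coherence, [p] applied to the unique 2-cell from the identity of [U] to the terminal
   [r !_U]. *)
pose rho : p ⟶ (p ⊙ r) ⊙ bang1 T U :=
  bwd (assoc p r (bang1 T U)) ∘ (p ◁ to_terminal (k U) (id1 U)) ∘ bwd (runit p).
exists (p ⊙ r), rho => K.
apply: is_slice_like_target_iso (iso_inv (assoc p r (bang1 T K))) _
  (groupoid_fibration_slice_like (k K) (fib K)) => w /=.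
apply: (iso_cancel_l (i := assoc p r (bang1 T K))).
rewrite fwd_bwdK /tabulation_cell -(comp2_id p r).
rewrite -(comp_assoc (assoc p r _)) assoc_natural comp_assoc.
rewrite -(comp_assoc (assoc p r _)) pentagon.
rewrite /rho !rwhisker_comp !comp_assoc.
have /= -> := fwd_bwdK (rwhisker_iso w (assoc p r (bang1 T U))).
rewrite -(comp_assoc (assoc p _ w)) assoc_natural -!comp_assoc.
apply: (iso_cancel_r (i := rwhisker_iso w (runit p))) => /=.
rewrite !comp_assoc; have /= -> := bwd_fwd (rwhisker_iso w (runit p)).
rewrite comp_idr -triangle -!comp_assoc -!lwhisker_comp.
congr ((p ◁ _) ∘ _); exact: to_terminal_unique (k K) _ _ _.
Qed.

Lemma universal_cell_groupoid_fibration (M : Bicategory) (T : TerminalData M)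
    (X : M) (u : M (one T) X) (U : M) (p : M U X) (rho : p ⟶ u ⊙ bang1 T U) :
  is_universal_cell rho -> is_groupoid_fibration p.
Proof.
move=> univ K.
exact: slice_like_groupoid_fibration (@tabulation_cell_natural _ _ _ _ _ _ rho K) (univ K).
Qed.

Lemma universal_cell_lift_iso (M : Bicategory) (T : TerminalData M)
    (X : M) (u : M (one T) X) (U : M) (p : M U X) (rho : p ⟶ u ⊙ bang1 T U)
    (K : M) (v w : M K U) (b : Iso (p ⊙ v) (p ⊙ w)) :
  is_universal_cell rho -> tabulation_cell rho w ∘ b = tabulation_cell rho v ->
  exists s : Iso v w, p ◁ s = b.
Proof.
move=> univ e.
exact: (slice_like_lift_iso (@tabulation_cell_natural _ _ _ _ _ _ rho K) (univ K) e).
Qed.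

(** The composite [q (e f) ≅ p f ≅ q] respects the cells into [u !_V], so it lifts along [q].
    Exchanging the roles of the two cells yields the other inverse law. *)
Lemma universal_cell_comparison_inverse (M : Bicategory) (T : TerminalData M)
    (X : M) (u : M (one T) X) (U V : M) (p : M U X) (q : M V X)
    (rho : p ⟶ u ⊙ bang1 T U) (sigma : q ⟶ u ⊙ bang1 T V)
    (e : M U V) (i : Iso (q ⊙ e) p) (f : M V U) (j : Iso (p ⊙ f) q) :
  is_universal_cell sigma ->
  rho ∘ i = tabulation_cell sigma e -> sigma ∘ j = tabulation_cell rho f ->
  inhabited (Iso (e ⊙ f) (id1 V)).
Proof.
move=> univ ei ej.
pose b : Iso (q ⊙ (e ⊙ f)) (q ⊙ id1 V) :=
  iso_comp (iso_inv (runit q))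
    (iso_comp j (iso_comp (rwhisker_iso f i) (iso_inv (assoc q e f)))).
have [|s _] := universal_cell_lift_iso (b := b) univ; last by split.
rewrite tabulation_cell_id /= comp_assoc fwd_bwdK -(comp_assoc sigma) ej.
rewrite -(comp_assoc (tabulation_cell rho f)) -tabulation_cell_whisker ei.
by rewrite tabulation_cell_comp1 comp_assoc fwd_bwd comp_idr.
Qed.

Lemma universal_cell_comparison (M : Bicategory) (T : TerminalData M)
    (X : M) (u : M (one T) X) (U V : M) (p : M U X) (q : M V X)
    (rho : p ⟶ u ⊙ bang1 T U) (sigma : q ⟶ u ⊙ bang1 T V) :
  is_universal_cell rho -> is_universal_cell sigma ->
  exists e : M U V, is_equivalence e /\ inhabited (Iso (q ⊙ e) p).
Proof.
move=> univ univ'.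
have [e [i ei]] := proj1 (univ' U) _ rho.
have [f [j ej]] := proj1 (univ V) _ sigma.
exists e; split; last by split.
exists f; split.
- exact: universal_cell_comparison_inverse univ ej ei.
- exact: universal_cell_comparison_inverse univ' ei ej.
Qed.

Lemma Tab_groupoid_fibrationP (M : Bicategory) (T : TabulationsFromTerminal M) (U X : M)
    (p : M U X) :
  Tab T p <-> is_groupoid_fibration p.
Proof.
split=> [[u [rho /is_tabulationP[_ univ]]]|fib].
  exact: universal_cell_groupoid_fibration univ.
have [u [rho univ]] := groupoid_fibration_universal_cell T fib.
exists u, rho; apply/is_tabulationP; split=> //.
(* Left adjointness is transferred from the leg [q] of an existing tabulation of the same [u]: [p]
   is isomorphic to [q] composed with an equivalence. *)
have [V [q [sigma /is_tabulationP[adj univ']]]] := has_tabulations u.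
have [e [eqv [i]]] := universal_cell_comparison univ univ'.
apply: is_left_adjoint_iso i _; apply: is_left_adjoint_comp adj _.
exact: equivalence_is_left_adjoint.
Qed.

(** * Closure properties of groupoid fibrations in a bicategory *)

Lemma groupoid_fibration_iso (M : Bicategory) (A B : M) (f g : M A B) :
  Iso f g -> is_groupoid_fibration f -> is_groupoid_fibration g.
Proof.
move=> i fib K; apply: groupoid_fibration_natiso (fib K).
exists (fun w => rwhisker_iso w i : Iso (postcomp K f w) (postcomp K g w)).
by move=> x y s; rewrite /= whisker_exchange.
Qed.

Definition postcomp_comp1 (M : Bicategory) (A B C : M) (p : M B C) (q : M A B)
    (K : M) :
  NatIso (postcomp K (p ⊙ q)) (functor_comp (postcomp K p) (postcomp K q)).
Proof.
exists (fun w => assoc p q w : Iso (postcomp K (p ⊙ q) w)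
                                 (functor_comp (postcomp K p) (postcomp K q) w)).
by move=> x y s; rewrite /= -comp2_id assoc_natural.
Defined.

Definition natiso_sym (C D : Category) (F G : Functor C D) (i : NatIso F G) :
  NatIso G F.
Proof.
exists (fun x => iso_inv (i x)) => x y f /=.
apply: (iso_cancel_l (i := i y)).
by rewrite fwd_bwdK -comp_assoc natiso_natural comp_assoc fwd_bwd comp_idr.
Defined.

Lemma groupoid_fibration_comp1 (M : Bicategory) (A B C : M) (p : M B C)
    (q : M A B) :
  is_groupoid_fibration p ->
  (is_groupoid_fibration (p ⊙ q) <-> is_groupoid_fibration q).
Proof.
move=> fibp; split=> fib K.
- apply: groupoid_fibration_cancel (fibp K) _.
  exact: groupoid_fibration_natiso (postcomp_comp1 p q K) (fib K).
- apply: groupoid_fibration_natiso (natiso_sym (postcomp_comp1 p q K)) _.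
  exact: groupoid_fibration_comp.
Qed.

(** * Right liftings and bipullbacks *)

(** Precomposition in [M] is postcomposition in [opposite M], so facts about the
    latter transfer to the former. *)
Definition opposite (M : Bicategory) : Bicategory.
Proof.
refine {|
  bob := M;
  bhom := fun A B => M B A;
  id1 := fun A => id1 A : M A A;
  comp1 := fun A B C (g : M C B) (f : M B A) => f ⊙ g;
  comp2 := fun A B C g g' f f' b a => comp2 (b := M) a b;
  assoc := fun A B C D h g f => iso_inv (@assoc M _ _ _ _ f g h);
  lunit := fun A B f => @runit M _ _ f;
  runit := fun A B f => @lunit M _ _ f |}.
- by move=> *; apply: comp2_id.
- by move=> *; apply: comp2_comp.
- by move=> * /=; symmetry; apply: assoc_bwd_natural.
- by move=> *; apply: runit_natural.
- by move=> *; apply: lunit_natural.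
- move=> A B C D E k h g f /=.
  apply: (iso_cancel_l (i := assoc (f ⊙ g) h k)).
  apply: (iso_cancel_l (i := assoc f g (h ⊙ k))).
  rewrite fwd_bwdK fwd_bwd -comp_assoc pentagon !comp_assoc.
  have /= -> := fwd_bwdK (rwhisker_iso k (assoc f g h)).
  by rewrite fwd_bwdK; have /= -> := fwd_bwd (lwhisker_iso f (assoc g h k)).
- by move=> A B C g f /=; rewrite -triangle comp_assoc fwd_bwd comp_idr.
Defined.

Definition adjunction_opposite (M : Bicategory) (A B : M) (f : M A B)
    (g : M B A) (a : Adjunction f g) :
  Adjunction (M := opposite M) (A := A) (B := B) g f.
Proof.
exact: (@Build_Adjunction (opposite M) A B g f (adj_unit a) (adj_counit a)
            (adj_triangle_r a) (adj_triangle_l a)).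
Defined.

(** Bijectivity in [s] says that [r ⊙ f] is a right lifting of [u ⊙ f] through [n]. *)
Definition lifting_cell (M : Bicategory) (K L Y Z : M) (n : M Y Z) (r : M L Y)
    (u : M L Z) (pi : n ⊙ r ⟶ u) (f : M K L) (x : M K Y) (s : x ⟶ r ⊙ f) :
  n ⊙ x ⟶ u ⊙ f :=
  (pi ▷ f) ∘ bwd (assoc n r f) ∘ (n ◁ s).

(** With [f ⊣ g], 2-cells [x ⟶ r f] correspond to 2-cells [x g ⟶ r]. *)
Lemma left_adjoint_respects_lifting (M : Bicategory) (K L Y Z : M) (n : M Y Z)
    (r : M L Y) (u : M L Z) (pi : n ⊙ r ⟶ u) (f : M K L) :
  (forall (v : M L Y) (t : n ⊙ v ⟶ u), exists! s : v ⟶ r, pi ∘ (n ◁ s) = t) ->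
  is_left_adjoint f ->
  forall (x : M K Y) (t : n ⊙ x ⟶ u ⊙ f), exists! s, lifting_cell pi (f := f) s = t.
Proof.
move=> univ [g [a]] x t; pose a' := adjunction_opposite a.
(* Unit and counit for precomposition with [g] as left adjoint of precomposition with [f]; [eta_n]
   and [eps_n] express compatibility with whiskering by [n]. *)
pose eta (W : M) (y : M K W) : y ⟶ (y ⊙ g) ⊙ f :=
  unit_at (M := opposite M) (adj_unit a') y.
pose eps (W : M) (y : M L W) : (y ⊙ f) ⊙ g ⟶ y :=
  counit_at (M := opposite M) (adj_counit a') y.
have eta_nat W (y y' : M K W) (s : y ⟶ y') : eta _ y' ∘ s = ((s ▷ g) ▷ f) ∘ eta _ y.
  exact: (unit_at_natural (M := opposite M) (adj_unit a') s).
have eps_nat W (y y' : M L W) (s : y ⟶ y') : eps _ y' ∘ ((s ▷ f) ▷ g) = s ∘ eps _ y.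
  exact: (counit_at_natural (M := opposite M) (adj_counit a') s).
have tri1 W (y : M L W) : (eps _ y ▷ f) ∘ eta _ (y ⊙ f) = idm _.
  exact: (unit_at_counit_at a' y).
have eta_n : (bwd (assoc n x g) ▷ f) ∘ bwd (assoc n (x ⊙ g) f) ∘ (n ◁ eta _ x)
    = eta _ (n ⊙ x).
  exact: (unit_at_comp1 (M := opposite M) (adj_unit a') x n).
have eps_n : eps _ (n ⊙ r) ∘ (bwd (assoc n r f) ▷ g) ∘ bwd (assoc n (r ⊙ f) g)
    = n ◁ eps _ r.
  exact: (counit_at_comp1 (M := opposite M) (adj_counit a') r n).
clearbody eta eps.
(* Transpose [t] to a 2-cell from [n (x g)] to [u], lift it through [pi], and transpose back. *)
have [s [es U]] := univ (x ⊙ g) (eps _ u ∘ (t ▷ g) ∘ bwd (assoc n x g)).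
exists ((s ▷ f) ∘ eta _ x); split.
- rewrite /lifting_cell lwhisker_comp -!comp_assoc.
  rewrite (comp_assoc (pi ▷ f)) -assoc_bwd_natural -!comp_assoc -rwhisker_comp es.
  rewrite !rwhisker_comp !comp_assoc eta_n -eta_nat.
  by rewrite -(comp_assoc (eps _ u ▷ f)) tri1 comp_idl.
- move=> s' es'.
  have -> : s = eps _ r ∘ (s' ▷ g).
    apply: U; rewrite lwhisker_comp -eps_n -es' /lifting_cell.
    rewrite !rwhisker_comp !comp_assoc -!assoc_bwd_natural.
    by rewrite -(comp_assoc (eps _ u)) eps_nat !comp_assoc.
  by rewrite rwhisker_comp comp_assoc -eta_nat -comp_assoc tri1 comp_idl.
Qed.

Lemma lifting_cell_comp (M : Bicategory) (K L Y Z : M) (n : M Y Z) (r : M L Y)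
    (u : M L Z) (pi : n ⊙ r ⟶ u) (f : M K L) (x y : M K Y) (s : y ⟶ r ⊙ f)
    (b : x ⟶ y) :
  lifting_cell pi (s ∘ b) = lifting_cell pi s ∘ (n ◁ b).
Proof. by rewrite /lifting_cell lwhisker_comp !comp_assoc. Qed.

(** Pasting with [pi] commutes with restriction along [w], since the two act on different sides of
    [rho]. *)
Lemma lifting_cell_tabulation_cell (M : Bicategory) (T : TerminalData M)
    (Y Z : M) (n : M Y Z) (r : M (one T) Y) (u : M (one T) Z) (pi : n ⊙ r ⟶ u)
    (P : M) (c : M P Y) (rho : c ⟶ r ⊙ bang1 T P) (K : M) (w : M K P) :
  lifting_cell pi (tabulation_cell rho w) ∘ assoc n c w =
  tabulation_cell (lifting_cell pi rho) w.
Proof.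
rewrite /lifting_cell /tabulation_cell !lwhisker_comp !rwhisker_comp !comp_assoc.
rewrite -assoc_natural -(comp_assoc (assoc u _ w)) (assoc_natural pi) comp2_id.
rewrite -!comp_assoc -whisker_exchange; congr (_ ∘ _); rewrite !comp_assoc.
congr (_ ∘ _); rewrite -(comp_assoc (bwd _)) -assoc_bwd_natural comp2_id.
rewrite !comp_assoc; congr (_ ∘ _).
apply: (iso_cancel_l (i := assoc n r (bang1 T P ⊙ w))); rewrite fwd_bwdK.
apply: (iso_cancel_r (i := rwhisker_iso w (assoc n r (bang1 T P)))).
rewrite /= !comp_assoc; have /= -> := bwd_fwd (rwhisker_iso w (assoc n r (bang1 T P))).
by rewrite comp_idr pentagon.
Qed.

Lemma pseudo_comma_iso (X Y Z : Category) (F : Functor X Z) (G : Functor Y Z)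
    (a b : pseudo_comma F G) (i : Iso (ps_fst a) (ps_fst b))
    (j : Iso (ps_snd a) (ps_snd b)) :
  fmap G j ∘ ps_iso a = ps_iso b ∘ fmap F i -> inhabited (Iso a b).
Proof.
move=> e; have e' : fmap G (bwd j) ∘ ps_iso b = ps_iso a ∘ fmap F (bwd i).
  rewrite -[LHS]comp_idr -fmap_id -(fwd_bwd i) fmap_comp.
  rewrite comp_assoc -(comp_assoc (ps_iso b)) -e -!comp_assoc -fmap_comp.
  by rewrite bwd_fwd fmap_id comp_idl.
split; unshelve eexists (exist _ (fwd i, fwd j) e) (exist _ (bwd i, bwd j) e').
- by apply: sig_ext; rewrite /= !fwd_bwd.
- by apply: sig_ext; rewrite /= !bwd_fwd.
Qed.

Lemma right_lifter_bipullback (M : Bicategory) (T : TabulationsFromTerminal M)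
    (S U Y : M) (p : M S Y) (n : M U Y) :
  is_right_lifter n -> Tab T p ->
  exists (Q : M) (n' : M Q S) (p' : M Q U) (th : Iso (n ⊙ p') (p ⊙ n')),
    is_bipullback th /\ Tab T p'.
Proof.
move=> lifter [u [sigma /is_tabulationP[_ univS]]].
have [r [pi univ_pi]] := lifter _ u.
have [Q [p' [rho tab]]] := has_tabulations r.
have /is_tabulationP[_ univQ] := tab.
have lift K := left_adjoint_respects_lifting univ_pi (proj2_sig (bang T K)).
(* Pasting [rho] with [pi] puts [n p'] over [u !_Q]; the tabulation [sigma] classifies it by [n'],
   and [i] supplies the square. *)
have [n' [i ei]] := proj1 (univS Q) _ (lifting_cell pi rho).
pose th := iso_inv i.
have eth : tabulation_cell sigma n' ∘ th = lifting_cell pi rho.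
  by rewrite -ei comp_assoc fwd_bwd comp_idr.
exists Q, n', p', th; split; last by exists r, rho.
have thE K (w : M K Q) : tabulation_cell sigma (n' ⊙ w) ∘ postcomp_square_iso th w
    = lifting_cell pi (tabulation_cell rho w).
  apply: (iso_cancel_r (i := assoc n p' w)).
  rewrite lifting_cell_tabulation_cell -eth tabulation_cell_whisker.
  rewrite tabulation_cell_comp1 /= !(comp_assoc _ (assoc _ _ _)).
  by rewrite !comp_assoc bwd_fwd comp_idr.
move=> K; apply/is_equivalence_of_categoriesP; split.
- move=> [x y al] /=.
  (* Through [al], [n x] lies over [u !_K]. The lifting puts [x] over [r !_K], where [rho]
     classifies it by [w]. *)
  have [s [es _]] := lift K x (tabulation_cell sigma y ∘ al).
  have [w [j ej]] := proj1 (univQ K) _ s; exists w.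
  (* The isomorphism forced by compatibility with [j]; it lies over [u !_K] and so lifts to
     [n' w ≅ y]. *)
  pose b : Iso (p ⊙ (n' ⊙ w)) (p ⊙ y) :=
    iso_comp al (iso_comp (lwhisker_iso n j) (iso_inv (postcomp_square_iso th w))).
  have eb : b ∘ postcomp_square_iso th w = al ∘ (n ◁ j).
    rewrite /b; move: (postcomp_square_iso th w) => psi.
    by rewrite /= !comp_assoc bwd_fwd comp_idr.
  have [|k ek] := universal_cell_lift_iso (b := b) univS.
    apply: (iso_cancel_r (i := postcomp_square_iso th w)).
    rewrite thE -ej lifting_cell_comp es [LHS]comp_assoc [RHS]comp_assoc.
    by congr (_ ∘ _); exact: eb.
  apply: (@pseudo_comma_iso _ _ _ _ _ (functor_to_pseudo_comma (postcomp_square th K) w)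
            {| ps_fst := x; ps_snd := y; ps_iso := al |} j k).
  by move: eb; rewrite -ek.
- move=> w w' [[s t] /= e].
  have nat := natiso_natural (postcomp_square th K).
  (* Uniqueness of liftings reduces this to an equation over [u !_K], which follows from [e] and
     naturality for [sigma]. *)
  have es : tabulation_cell rho w' ∘ s = tabulation_cell rho w.
    have [v [_ U']] := lift K _ (lifting_cell pi (tabulation_cell rho w)).
    rewrite -(U' (tabulation_cell rho w)) // -(U' (_ ∘ s)) // lifting_cell_comp -!thE.
    by rewrite comp_assoc -e -comp_assoc tabulation_cell_natural.
  have [h [eh U']] := proj2 (univQ K) _ _ _ es.
  exists h; split.
    apply: sig_ext => /=; congr (_, _) => //.
    (* The second component is determined by the first because whiskering by [p] is faithful. *)
    apply: (slice_like_inj (@tabulation_cell_natural _ _ _ _ _ _ sigma K) (univS K)).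
    apply: (iso_cancel_r (i := postcomp_square_iso th w)).
    by rewrite -(nat _ _ h) [RHS]e -eh.
  by move=> h' /(f_equal (@proj1_sig _ _)) [eh' _]; apply: U'.
Qed.

Theorem theorem20 (M : Bicategory) (T : TabulationsFromTerminal M) :
  is_calibration (Tab T).
Proof.
split.
- move=> A B f eqf; apply/Tab_groupoid_fibrationP => K; apply: equivalence_groupoid_fibration.
    exact: equivalence_essentially_surjective.
  exact: equivalence_fully_faithful.
- move=> A B f g [i] /Tab_groupoid_fibrationP fib; apply/Tab_groupoid_fibrationP.
  exact: groupoid_fibration_iso i fib.
- move=> A B C p q /Tab_groupoid_fibrationP fib; rewrite !Tab_groupoid_fibrationP.
  exact: groupoid_fibration_comp1.
- by move=> A B p /Tab_groupoid_fibrationP.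
- move=> S U Y p n; exact: right_lifter_bipullback.
Qed.
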